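(* Let $k\in\mathbb{R}$ with $k\neq0$, let $f=f(x_4)$ be a smooth non-constant real-valued function on $\mathbb{R}$, and let $\mathcal{M}=(\mathbb{R}^4,g)$, where $g$ is the pseudo-Riemannian metric of signature $(2,2)$ whose (possibly) non-zero components, up to symmetry, are $$g(\partial_1,\partial_3)=g(\partial_2,\partial_4)=1,\qquad g(\partial_i,\partial_j)=\psi_{ij}\ \text{ for } i,j\in\{3,4\},$$ with $$\psi_{33}=4kx_1^2-\tfrac{1}{4k}f(x_4)^2,\qquad \psi_{44}=4kx_2^2,\qquad \psi_{34}=\psi_{43}=4kx_1x_2+x_2f(x_4)-\tfrac{1}{4k}\dot f(x_4).$$ Then $\mathcal{M}$ is Osserman with eigenvalues $\{0,4k,k,k\}$, and the Jacobi operators are diagonalizable at a point $P=(x_1,x_2,x_3,x_4)$ if and only if $$24kf(x_4)\dot f(x_4)x_2-12k\ddot f(x_4)x_1+3f(x_4)\ddot f(x_4)+4\dot f(x_4)^2=0.$$ Furthermore, $\mathcal{M}$ is geodesically incomplete and cannot be embedded isometrically in a geodesically complete manifold.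
   Context: $(x_1,x_2,x_3,x_4)$ are the standard coordinates on $\mathbb{R}^4$, $\partial_i=\partial/\partial x_i$, and $\dot f,\ddot f$ are the first and second derivatives of $f$. With $\nabla$ the Levi-Civita connection, the curvature operator is $\mathcal{R}(x,y)=\nabla_x\nabla_y-\nabla_y\nabla_x-\nabla_{[x,y]}$ and the Jacobi operator of a tangent vector $x$ is $\mathcal{J}(x):y\mapsto\mathcal{R}(y,x)x$. A pseudo-Riemannian manifold of signature $(p,q)$ with $p,q>0$ is pointwise Osserman if, for each point $P$, the spectrum of $\mathcal{J}$ is constant on the unit spacelike tangent vectors at $P$ (equivalently, on the unit timelike tangent vectors at $P$); it is globally Osserman if this spectrum moreover does not depend on $P$. The eigenvalues $\{0,4k,k,k\}$ are listed with multiplicity, for $\mathcal{J}(x)$ with $x$ unit spacelike. A pseudo-Riemannian manifold is geodesically complete if all its geodesics exist for all time, and geodesically incomplete otherwise.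
   Formalization: ''Cannot be embedded isometrically in a geodesically complete manifold'' is proved for target manifolds of the same dimension 4 (any signature); in arbitrary dimension it fails, since by Nash and Clarke every such manifold embeds isometrically in a complete flat pseudo-Euclidean space. *)

(* Defs.v *)
From HB Require Import structures.
From mathcomp Require Import all_boot all_order all_algebra.
From mathcomp Require Import all_classical all_reals all_analysis.

Set Implicit Arguments.
Unset Strict Implicit.
Unset Printing Implicit Defensive.

Import Order.TTheory GRing.Theory Num.Theory.
Import numFieldNormedType.Exports.

Local Open Scope ring_scope.
Local Open Scope classical_set_scope.

(* Tangent vectors are row vectors of components in a coordinate frame, and    *)
(* linear operators act on them from the right: [v *m A].                      *)

(* C^oo on the open set [U]: differentiability of every iterated directional   *)
(* derivative already gives their continuity.                                  *)
Definition smooth_on (R : realType) (V W : normedModType R) (U : set V)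
    (f : V -> W) : Prop :=
  forall (vs : seq V) (x : V), U x ->
    differentiable (foldr (fun v h => 'D_v h) f vs) x.

Section Connection.
Context {R : realType} {n : nat}.
Implicit Types (g : 'rV[R]_n -> 'M[R]_n) (X Y Z : 'rV[R]_n -> 'rV[R]_n).
Implicit Types (x u v : 'rV[R]_n).

Definition inner g x u v : R := (u *m g x *m v^T) 0 0.

Definition partial (i : 'I_n) (h : 'rV[R]_n -> R) x : R :=
  'D_(delta_mx 0 i) h x.

Definition christoffel g x (k i j : 'I_n) : R :=
  2^-1 * \sum_l invmx (g x) k l *
    (partial i (fun y => g y j l) x + partial j (fun y => g y i l) x
     - partial l (fun y => g y i j) x).

Definition christoffel_form g x u v : 'rV[R]_n :=
  \row_k \sum_i \sum_j christoffel g x k i j * u 0 i * v 0 j.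

(* The Levi-Civita connection. *)
Definition nabla g X Y : 'rV[R]_n -> 'rV[R]_n :=
  fun x => 'D_(X x) Y x + christoffel_form g x (X x) (Y x).

Definition lie_bracket X Y : 'rV[R]_n -> 'rV[R]_n :=
  fun x => 'D_(X x) Y x - 'D_(Y x) X x.

Definition curvature g X Y Z : 'rV[R]_n -> 'rV[R]_n :=
  fun x => nabla g X (nabla g Y Z) x - nabla g Y (nabla g X Z) x
           - nabla g (lie_bracket X Y) Z x.

(* The curvature is tensorial, so tangent vectors at [x] may be extended to    *)
(* vector fields with constant components.                                     *)
Definition jacobi_operator g x v : 'M[R]_n :=
  lin1_mx (fun y => curvature g (cst y) (cst v) (cst v) x).

End Connection.

(* There are [p] timelike and [q] spacelike directions. *)
Definition has_signature (R : realType) (n p q : nat) (A : 'M[R]_n) : Prop :=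
  (p + q)%N = n /\
  exists2 P : 'M[R]_n, P \in unitmx &
    P *m A *m P^T = diag_mx (\row_(i < n) (if (i < p)%N then -1 else 1)).

(* An atlas with, in each chart, the components of a metric. The maps [coord]  *)
(* and [param] are mutually inverse between [dom c] and [chart_image c]; their       *)
(* values elsewhere, and those of [metric c] outside [chart_image c], are junk.      *)
Record manifold_data (R : realType) (n : nat) := ManifoldData {
  carrier :> topologicalType;
  chart : Type;
  dom : chart -> set carrier;
  coord : chart -> carrier -> 'rV[R]_n;
  param : chart -> 'rV[R]_n -> carrier;
  metric : chart -> 'rV[R]_n -> 'M[R]_n }.

Definition chart_image (R : realType) (n : nat) (M : manifold_data R n)
  (c : chart M) : set 'rV[R]_n := coord c @` dom c.

Section Maps.
Context {R : realType} {m n : nat}.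
Context {M : manifold_data R m} {N : manifold_data R n}.
Implicit Types (F : M -> N) (c : chart M) (d : chart N).

Definition in_charts F c d : 'rV[R]_m -> 'rV[R]_n :=
  coord d \o F \o param c.

Definition smooth_map F : Prop :=
  continuous F /\
  forall c d, smooth_on (coord c @` (dom c `&` F @^-1` dom d)) (in_charts F c d).

Definition preserves_metric F : Prop :=
  forall c d (p : M), dom c p -> dom d (F p) ->
    let T := 'J (in_charts F c d) (coord c p) in
    metric c (coord c p) = T *m metric d (coord d (F p)) *m T^T.

(* A smooth isometric map is an immersion because the metric of [M] is         *)
(* nondegenerate; the last two conditions make it a homeomorphism onto its     *)
(* image.                                                                      *)
Definition isometric_embedding F : Prop :=
  [/\ smooth_map F, preserves_metric F, injective F &
      forall U : set M, open U ->
        exists2 V : set N, open V & F @` U = V `&` range F].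

End Maps.

(* For the identity map, [smooth_map] is the smoothness of the transition      *)
(* functions and [preserves_metric] is the transformation rule of the metric.  *)
Definition pseudo_riemannian (R : realType) (n p q : nat)
    (M : manifold_data R n) : Prop :=
  [/\ hausdorff_space M /\ @second_countable M,
      forall x : M, exists c : chart M, dom c x,
      forall c : chart M,
        [/\ open (dom c), open (chart_image c),
            {within dom c, continuous (coord c)},
            {within chart_image c, continuous (param c)} &
            forall x : M, dom c x -> param c (coord c x) = x],
      smooth_map (@idfun M) /\ preserves_metric (@idfun M) &
      forall c : chart M,
        smooth_on (chart_image c) (metric c) /\
        forall x, chart_image c x -> has_signature p q (metric c x)].

Section Geometry.
Context {R : realType} {n : nat}.
Variable M : manifold_data R n.
Implicit Types (c d : chart M) (P Q : M) (v w : 'rV[R]_n).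

Definition inner_at c P v w : R := inner (metric c) (coord c P) v w.

Definition jacobi_at c P v : 'M[R]_n :=
  jacobi_operator (metric c) (coord c P) v.

Definition geodesic_on (I : set R) (gamma : R -> M) : Prop :=
  forall t, I t ->
    {for t, continuous gamma} /\
    forall c, dom c (gamma t) ->
      let sigma : R -> 'rV[R]_n := coord c \o gamma in
      [/\ \forall s \near t, derivable sigma s 1,
          derivable (derive1 sigma) t 1 &
          derive1n 2 sigma t
          + christoffel_form (metric c) (sigma t) (derive1 sigma t)
              (derive1 sigma t)
          = 0].

Definition geodesically_complete : Prop :=
  forall (I : set R) (gamma : R -> M),
    open I -> is_interval I -> geodesic_on I gamma ->
    exists2 gamma' : R -> M, geodesic_on setT gamma' &
      forall t, I t -> gamma' t = gamma t.

Definition geodesically_incomplete : Prop := ~ geodesically_complete.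

(* Spectra are compared with multiplicities, as characteristic polynomials. *)
Definition globally_osserman : Prop :=
  forall c P v d Q w,
    dom c P -> inner_at c P v v = 1 -> dom d Q -> inner_at d Q w w = 1 ->
    char_poly (jacobi_at c P v) = char_poly (jacobi_at d Q w).

Definition osserman_with_eigenvalues (s : seq R) : Prop :=
  globally_osserman /\
  forall c P v, dom c P -> inner_at c P v v = 1 ->
    char_poly (jacobi_at c P v) = \prod_(a <- s) ('X - a%:P).

(* Null vectors are excluded: for an Osserman metric their Jacobi operators    *)
(* are nilpotent.                                                              *)
Definition jacobi_operators_diagonalizable (P : M) : Prop :=
  forall c v, dom c P -> inner_at c P v v = 1 \/ inner_at c P v v = -1 ->
    diagonalizable (jacobi_at c P v).

End Geometry.

Definition coordinate_space (R : realType) (n : nat)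
    (g : 'rV[R]_n -> 'M[R]_n) : manifold_data R n :=
  @ManifoldData R n 'rV[R]_n unit
    (fun=> setT) (fun=> idfun) (fun=> idfun) (fun=> g).

Section Example.
Context {R : realType}.
Variables (k : R) (f : R -> R).
Implicit Type x : 'rV[R]_4.

(* The coordinates x_1, x_2 and x_4 have indices 0, 1 and 3. *)
Definition x1 x : R := x 0 (inord 0).
Definition x2 x : R := x 0 (inord 1).
Definition x4 x : R := x 0 (inord 3).

Definition psi33 x : R := 4 * k * x1 x ^+ 2 - (4 * k)^-1 * f (x4 x) ^+ 2.
Definition psi44 x : R := 4 * k * x2 x ^+ 2.
Definition psi34 x : R :=
  4 * k * x1 x * x2 x + x2 x * f (x4 x) - (4 * k)^-1 * derive1 f (x4 x).

Definition walker_metric x : 'M[R]_4 :=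
  \matrix_(i < 4, j < 4) nth 0 (nth [::]
    [:: [:: 0; 0; 1;       0      ];
        [:: 0; 0; 0;       1      ];
        [:: 1; 0; psi33 x; psi34 x];
        [:: 0; 1; psi34 x; psi44 x]] i) j.

End Example.

(* Main.v *)
Require Import Defs.
From HB Require Import structures.
From mathcomp Require Import all_boot all_order all_algebra.
From mathcomp Require Import all_classical all_reals all_analysis.
From mathcomp Require Import ring lra.
Import Order.TTheory GRing.Theory Num.Theory.
Import numFieldNormedType.Exports.
Local Open Scope ring_scope.
Local Open Scope classical_set_scope.

(** The metric is a deformation of the space of constant para-holomorphic
    sectional curvature: on every tangent space there is a para-complex
    structure [para], skew for the metric, such that
[[
      R(y, v) v = k (g(v, v) y - g(y, v) v) - 3 k g(y, para v) para v
                  + rho g(y, v#) v#,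
]]
    where [v# = (v_4, - v_3, 0, 0)] is null and orthogonal to [v] and to
    [para v] ([curvature_walker]). If [g(v, v) = 1], then [v], [para v] and [v#]
    are eigenvectors for [0], [4 k] and [k], and a fourth vector [e], orthogonal
    to [v] and [para v], satisfies [J e = k e + c rho v#] with [c <> 0]. So the
    spectrum is [{0, 4 k, k, k}], with a Jordan block exactly where [rho] does
    not vanish ([osserman_char_poly], [osserman_diagonalizable]); up to the
    factor [12 k], [rho] is the polynomial of the theorem.

    Incompleteness is the case of the identity in the statement on embeddings.
    For that statement, choose [c0] where neither [f] nor its derivative
    vanishes. For [c] near [c0] the curve
[[
      Phi c t = (- f(c) / (4 k), f'(c) x_3 / (2 k), x_3, c),   x_3 = ln t / f(c),
]]
    is a null geodesic for [t > 0]. The variation field [eta] of this family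
    satisfies [g(eta, eta) = f''(c) x_3 / k + f'(c)^2 x_3^2 / k], which is
    unbounded as [t] tends to [0] ([variation_field_norm]).

    Suppose that an isometry [F] maps this family into a complete manifold of
    dimension 4. Isometries between manifolds of the same dimension map geodesics
    to geodesics ([isometry_geodesic], which follows from the Koszul formula and
    the symmetry of second derivatives), so the image of [Phi c0] extends to a
    geodesic through the time [0], and in a chart around its position there the
    geodesic equation has Lipschitz coefficients. Gronwall's inequality, applied
    to the images of [Phi c] and [Phi c0], bounds their distance at time [t] by
    their distance at a fixed time [t1 > t], with a constant that does not depend
    on [t] ([second_order_comparison]). Dividing by [c - c0] shows that the image
    of [eta] is bounded as [t] tends to [0], and therefore so is [g(eta, eta)]
    ([embedded_variation_bounded]). This is a contradiction. *)

(** * Directional derivatives *)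

Section DirectionalDerivatives.
Context {R : realType} {V W : normedModType R}.

Lemma derive_linear_comb (f : V -> W) (x : V) (I : Type) (r : seq I)
    (a : I -> R) (e : I -> V) :
  differentiable f x ->
  'D_(\sum_(i <- r) a i *: e i) f x = \sum_(i <- r) a i *: 'D_(e i) f x.
Proof.
move=> df; rewrite deriveE// linear_sum; apply: eq_bigr => i _.
by rewrite linearZ/= deriveE.
Qed.

Lemma is_derive_comp_curve (f : V -> W) (c : R -> V) (t : R) (v : V) :
  is_derive t 1 c v -> differentiable f (c t) ->
  is_derive t 1 (f \o c) ('D_v f (c t)).
Proof.
move=> [dc <-] df.
have dc' : differentiable c t by apply/derivable1_diffP.
have dfc : differentiable (f \o c) t by exact: differentiable_comp.
apply: DeriveDef; first exact/diff_derivable.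
by rewrite deriveE// diff_comp//= -deriveE// -deriveE.
Qed.

Lemma derive_comp_curve (f : V -> W) (c : R -> V) (t : R) :
  derivable c t 1 -> differentiable f (c t) ->
  'D_1 (f \o c) t = 'D_('D_1 c t) f (c t).
Proof.
by move=> dc df; have [] := is_derive_comp_curve _ _ _ _ (derivableP dc) df.
Qed.

Lemma is_derive_line (x v : V) (t : R) : is_derive t 1 (fun s : R => x + s *: v) v.
Proof.
have dl : differentiable (fun s : R => x + s *: v) t by [].
apply: DeriveDef; first exact/diff_derivable.
by rewrite deriveE// diff_val/= add0r scale1r.
Qed.

Lemma is_derive_along_line (f : V -> W) (x v : V) (t : R) :
  differentiable f (x + t *: v) ->
  is_derive t 1 (fun s : R => f (x + s *: v)) ('D_v f (x + t *: v)).
Proof.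
move=> df.
exact: (is_derive_comp_curve f (fun s : R => x + s *: v) t v (is_derive_line x v t)).
Qed.

End DirectionalDerivatives.

Section Matrices.
Context {R : realType} {V : normedModType R} {m n : nat}.

Lemma differentiable_mxP (M : V -> 'M[R]_(m, n)) x :
  differentiable M x <-> forall i j, differentiable (fun y => M y i j) x.
Proof.
split=> [dM i j|dM].
  have := @differentiable_comp _ _ _ _ M (fun A : 'M[R]_(m, n) => A i j) x dM.
  by apply; exact: differentiable_coord.
rewrite (_ : M = fun y => \sum_(i < m) \sum_(j < n) M y i j *: delta_mx i j).
  have dij i j : differentiable (fun y => M y i j *: (delta_mx i j : 'M[R]_(m, n))) x.
    exact: differentiableZl.
  rewrite (_ : (fun y => _) =
      \sum_(i < m) \sum_(j < n) fun y => M y i j *: (delta_mx i j : 'M[R]_(m, n))).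
    by apply: differentiable_sum => i; exact: differentiable_sum.
  apply/funext => y; rewrite fct_sumE; apply: eq_bigr => i _.
  by rewrite fct_sumE.
by apply/funext => y; exact: matrix_sum_delta.
Qed.

Lemma derive_coord (M : V -> 'M[R]_(m, n)) x v i j :
  derivable M x v -> ('D_v M x) i j = 'D_v (fun y => M y i j) x.
Proof. by move=> dM; rewrite derive_mx// mxE. Qed.

End Matrices.

Section PointwiseDerivatives.
Context {R : realType} {V : normedModType R}.
Implicit Types (p q : V -> R) (x v : V).

Lemma is_derive_add p q x v dp dq :
  is_derive x v p dp -> is_derive x v q dq ->
  is_derive x v (fun z => p z + q z) (dp + dq).
Proof. by move=> dp' dq'; exact: is_deriveD. Qed.

Lemma is_derive_sub p q x v dp dq :
  is_derive x v p dp -> is_derive x v q dq ->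
  is_derive x v (fun z => p z - q z) (dp - dq).
Proof. by move=> dp' dq'; exact: is_deriveB. Qed.

Lemma is_derive_opp p x v dp :
  is_derive x v p dp -> is_derive x v (fun z => - p z) (- dp).
Proof. by move=> dp'; exact: is_deriveN. Qed.

Lemma is_derive_mul p q x v dp dq :
  is_derive x v p dp -> is_derive x v q dq ->
  is_derive x v (fun z => p z * q z) (p x * dq + q x * dp).
Proof. by move=> dp' dq'; exact: is_deriveM. Qed.

Lemma is_derive_const (a : R) x v : is_derive x v (fun=> a) 0.
Proof. exact: is_derive_cst. Qed.

Lemma differentiable_add p q x : differentiable p x -> differentiable q x ->
  differentiable (fun z => p z + q z) x.
Proof. exact: differentiableD. Qed.

Lemma differentiable_sub p q x : differentiable p x -> differentiable q x ->
  differentiable (fun z => p z - q z) x.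
Proof. exact: differentiableB. Qed.

Lemma differentiable_mul p q x : differentiable p x -> differentiable q x ->
  differentiable (fun z => p z * q z) x.
Proof. exact: differentiableM. Qed.

Lemma differentiable_const (a : R) x : differentiable (fun=> a : R) x.
Proof. exact: differentiable_cst. Qed.

Lemma is_derive_mxP {m n : nat} (M : V -> 'M[R]_(m, n)) x v (dM : 'M[R]_(m, n)) :
  (forall i j, is_derive x v (fun z => M z i j) (dM i j)) -> is_derive x v M dM.
Proof.
move=> dMij; have dMx : derivable M x v by apply/derivable_mxP => i j; have [] := dMij i j.
apply: DeriveDef => //; rewrite derive_mx//; apply/matrixP => i j; rewrite mxE.
by have [] := dMij i j.
Qed.

End PointwiseDerivatives.

Lemma is_derive_congr {R : realType} {V W : normedModType R} (p : V -> W) x v dp dp' :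
  is_derive x v p dp -> dp = dp' -> is_derive x v p dp'.
Proof. by move=> dpx <-. Qed.

Lemma derive_of {R : realType} {V W : normedModType R} (p : V -> W) x v dp :
  is_derive x v p dp -> 'D_v p x = dp.
Proof. by case. Qed.

(* The summands and factors are matched syntactically, since unification would
   unfold the functions at the leaves. *)
Ltac derive_pointwise base :=
  lazymatch goal with
  | |- is_derive _ _ (fun z => @?p z - @?q z) _ =>
      notypeclasses refine (is_derive_sub p q _ _ _ _ _ _); derive_pointwise base
  | |- is_derive _ _ (fun z => @?p z + @?q z) _ =>
      notypeclasses refine (is_derive_add p q _ _ _ _ _ _); derive_pointwise base
  | |- is_derive _ _ (fun z => - @?p z) _ =>
      notypeclasses refine (is_derive_opp p _ _ _ _); derive_pointwise base
  | |- is_derive _ _ (fun z => @?p z * @?q z) _ =>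
      notypeclasses refine (is_derive_mul p q _ _ _ _ _ _); derive_pointwise base
  | |- _ => first [notypeclasses refine (is_derive_const _ _ _) | base]
  end.

(* Type class search is switched off, since it would look for the derivative. *)
Ltac derive_by base :=
  notypeclasses refine (is_derive_congr _ _ _ _ _ _ _);
  [derive_pointwise base | rewrite /=].

Ltac differentiable_pointwise base :=
  lazymatch goal with
  | |- differentiable (fun z => @?p z - @?q z) _ =>
      apply: (differentiable_sub p q); differentiable_pointwise base
  | |- differentiable (fun z => @?p z + @?q z) _ =>
      apply: (differentiable_add p q); differentiable_pointwise base
  | |- differentiable (fun z => @?p z * @?q z) _ =>
      apply: (differentiable_mul p q); differentiable_pointwise base
  | |- _ => first [exact: differentiable_const | base]
  end.

(** * The Koszul formula *)

Lemma signature_unit {R : realType} (n p q : nat) (A : 'M[R]_n) :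
  has_signature p q A -> A \in unitmx.
Proof.
move=> [_ [P _ PAP]].
have : P *m A *m P^T \in unitmx.
  rewrite PAP unitmxE det_diag unitfE; apply/prodf_neq0 => i _; rewrite mxE.
  by case: ifP; rewrite ?oppr_eq0 oner_eq0.
by rewrite !unitmx_mul => /andP[/andP[]].
Qed.

Lemma signature_sym {R : realType} (n p q : nat) (A : 'M[R]_n) :
  has_signature p q A -> A^T = A.
Proof.
move=> [_ [P Pu PAP]].
apply: (can_inj (mulKmx Pu)).
have Pu' : P^T \in unitmx by rewrite unitmx_tr.
apply: (can_inj (mulmxK Pu')).
rewrite PAP; have := congr1 trmx PAP.
by rewrite tr_diag_mx !trmx_mul trmxK mulmxA.
Qed.

Section Koszul.
Context {R : realType} {n : nat}.
Implicit Types (g : 'rV[R]_n -> 'M[R]_n) (x u v w : 'rV[R]_n).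

Lemma innerE g x u v : inner g x u v = \sum_i \sum_j u 0 i * v 0 j * g x i j.
Proof.
rewrite /inner mxE exchange_big/=; apply: eq_bigr => j _.
rewrite !mxE mulr_suml; apply: eq_bigr => i _.
by rewrite mulrAC.
Qed.

Lemma innerC g x u v : (g x)^T = g x -> inner g x u v = inner g x v u.
Proof.
move=> gs; rewrite !innerE exchange_big/=; apply: eq_bigr => i _.
by apply: eq_bigr => j _; rewrite -[in LHS]gs mxE mulrAC [v 0 i * _]mulrC mulrAC.
Qed.

Lemma inner_nondegenerate g x u v : g x \in unitmx ->
  (forall w, inner g x u w = inner g x v w) -> u = v.
Proof.
move=> gu uv; apply: (can_inj (mulmxK gu)).
apply/rowP => i; have := uv (delta_mx 0 i).
by rewrite /inner trmx_delta -!colE !mxE.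
Qed.

Lemma derive_inner g x u v w : differentiable g x ->
  'D_w (fun y => inner g y u v) x =
  \sum_i \sum_j u 0 i * v 0 j * \sum_l w 0 l * partial l (fun y => g y i j) x.
Proof.
move=> /differentiable_mxP dg.
have dD i j v' : derivable (fun y => g y i j) x v' by exact: diff_derivable.
rewrite (_ : (fun y => _) =
    \sum_i \sum_j fun y => (u 0 i * v 0 j) *: (g y i j : R)); last first.
  apply/funext => y; rewrite innerE fct_sumE; apply: eq_bigr => i _.
  by rewrite fct_sumE.
rewrite derive_sum => [|i]; last by apply: derivable_sum => j; exact: derivableZ.
apply: eq_bigr => i _; rewrite derive_sum => [|j]; last exact: derivableZ.
apply: eq_bigr => j _; rewrite deriveZ//; congr (_ * _).
rewrite [w in LHS]row_sum_delta derive_linear_comb//.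
Qed.

(** Contracting the Christoffel symbols with the metric removes the inverse
    matrix, which leaves the Koszul formula for constant fields. As the metric is
    nondegenerate, this determines the connection: it is used both to verify an
    explicit connection and to compare connections under an isometry. *)
Lemma inner_christoffel g x u v w :
  differentiable g x -> (g x)^T = g x -> g x \in unitmx ->
  inner g x (christoffel_form g x u v) w = 2^-1 *
    ('D_u (fun y => inner g y v w) x + 'D_v (fun y => inner g y u w) x
     - 'D_w (fun y => inner g y u v) x).
Proof.
move=> dg gs gu.
pose first l := \sum_i \sum_j (partial i (fun y => g y j l) x
  + partial j (fun y => g y i l) x - partial l (fun y => g y i j) x)
  * u 0 i * v 0 j.
have -> : christoffel_form g x u v = 2^-1 *: (\row_l first l *m invmx (g x)).
  apply/rowP => k; rewrite !mxE mulr_sumr.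
  rewrite (eq_bigr (fun i => \sum_j \sum_l 2^-1 * (invmx (g x) k l *
    (partial i (fun y => g y j l) x + partial j (fun y => g y i l) x
     - partial l (fun y => g y i j) x) * u 0 i * v 0 j))); last first.
    move=> i _; apply: eq_bigr => j _.
    rewrite /christoffel -mulrA -mulrA mulr_suml mulr_sumr.
    by apply: eq_bigr => l _; rewrite !mulrA.
  rewrite (eq_bigr _ (fun i _ => exchange_big _ _ _ _ _ _))/=.
  rewrite exchange_big/=; apply: eq_bigr => l _; rewrite mxE.
  rewrite mulr_suml mulr_sumr; apply: eq_bigr => i _.
  rewrite mulr_suml mulr_sumr; apply: eq_bigr => j _.
  have -> : invmx (g x) k l = invmx (g x) l k.
    by rewrite -[in LHS]gs -trmx_inv mxE.
  by ring.
rewrite /inner -!scalemxAl mxE; congr (_ * _).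
rewrite mulmxKV// !derive_inner// mxE.
have norm3 (a : 'I_n -> 'I_n -> 'I_n -> R) (p q r : 'rV[R]_n) :
    \sum_i \sum_j p 0 i * q 0 j * (\sum_l r 0 l * a i j l) =
    \sum_i \sum_j \sum_l p 0 i * q 0 j * r 0 l * a i j l.
  apply: eq_bigr => i _; apply: eq_bigr => j _; rewrite mulr_sumr.
  by apply: eq_bigr => l _; rewrite mulrA.
rewrite !norm3.
rewrite [X in _ = X + _ - _](eq_bigr _ (fun i _ => exchange_big _ _ _ _ _ _))/=.
rewrite [X in _ = X + _ - _]exchange_big/=.
rewrite [X in _ = _ + X - _](eq_bigr _ (fun i _ => exchange_big _ _ _ _ _ _))/=.
rewrite [X in X = _](eq_bigr (fun l => \sum_i \sum_j (partial i (fun y => g y j l) x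
  + partial j (fun y => g y i l) x - partial l (fun y => g y i j) x)
  * u 0 i * v 0 j * w 0 l)); last first.
  move=> l _; rewrite !mxE mulr_suml; apply: eq_bigr => i _.
  by rewrite mulr_suml.
rewrite exchange_big/= -big_split -sumrB/=; apply: eq_bigr => i _.
rewrite exchange_big/= -big_split -sumrB/=; apply: eq_bigr => j _.
rewrite -big_split -sumrB/=; apply: eq_bigr => l _.
ring.
Qed.

End Koszul.

(** * Symmetry of second derivatives *)

Section Young.
Context {R : realType} {V : normedModType R}.
Implicit Types (f p q : V -> R) (x v w : V).

Lemma differentiable_approx f x (eps : R) : differentiable f x -> 0 < eps ->
  \forall u \near 0, `|f (x + u) - f x - 'd f x u| <= eps * `|u|.
Proof.
move=> df e0.
have E := diff_locallyxC df.
near=> u.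
have cancel (a b c : R) : a + b + c - a - b = c by ring.
rewrite E cancel.
near: u; exact: littleoP.
Unshelve. all: by end_near. Qed.

Definition second_difference f x v w (h : R) : R :=
  f (x + h *: v + h *: w) - f (x + h *: v) - (f (x + h *: w) - f x).

(** By the mean value theorem in the direction [v], the second difference is
    the increment of [p = 'D_v f] between two points that differ by [h *: w]. *)
Lemma second_difference_approx f p x v w (eps : R) :
  (\forall y \near x, differentiable f y /\ 'D_v f y = p y) ->
  differentiable p x -> 0 < eps ->
  \forall h \near 0^'+, `|second_difference f x v w h - h ^+ 2 * 'D_w p x| <= eps * h ^+ 2.
Proof.
move=> fp dp e0.
pose m := 2 * `|v| + `|w| + 1.
have m0 : 0 < m by rewrite /m ltr_wpDl// addr_ge0 ?mulr_ge0.
have em0 : 0 < eps / m by rewrite divr_gt0.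
have [/= d d0 pd] := (nbhs_ballP _ _).1 (differentiable_approx _ _ _ dp em0).
have [/= r r0 fr] := (nbhs_ballP _ _).1 fp.
near=> h.
have h0 : 0 < h by near: h; exact: nbhs_right_gt.
have hd : h * m < d.
  rewrite -ltr_pdivlMr//; near: h; apply: nbhs_right_lt; exact: divr_gt0.
have hr : h * m < r.
  rewrite -ltr_pdivlMr//; near: h; apply: nbhs_right_lt; exact: divr_gt0.
have small (s b : R) : 0 <= s <= 1 -> 0 <= b <= 1 ->
    `|(s * h) *: v + (b * h) *: w| < h * m /\
    `|(s * h) *: v + (b * h) *: w| <= h * (`|v| + b * `|w|).
  move=> /andP[s0 s1] /andP[b0 b1].
  have H : `|(s * h) *: v + (b * h) *: w| <= h * (`|v| + b * `|w|).
    rewrite (le_trans (ler_normD _ _))// !normrZ !ger0_norm ?mulr_ge0// ?(ltW h0)//.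
    rewrite mulrDr [h * (b * _)]mulrA [h * b]mulrC lerD2r -mulrA ler_piMl//.
    by rewrite mulr_ge0// ltW.
  split=> //; apply: le_lt_trans H _; rewrite ltr_pM2l// /m ltr_pwDr//.
  rewrite lerD// ?ler_piMl//; have := normr_ge0 v; lra.
pose F (s : R) := f (x + h *: w + s *: (h *: v)) - f (x + s *: (h *: v)).
pose dF (s : R) := h * (p (x + h *: w + s *: (h *: v)) - p (x + s *: (h *: v))).
have nearx (s b : R) : 0 <= s <= 1 -> 0 <= b <= 1 ->
    differentiable f (x + (b * h) *: w + s *: (h *: v)) /\
    'D_v f (x + (b * h) *: w + s *: (h *: v)) = p (x + (b * h) *: w + s *: (h *: v)).
  move=> s01 b01; apply: fr; rewrite -ball_normE /ball_/= -addrA opprD addrA subrr.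
  rewrite add0r normrN addrC scalerA.
  by apply: lt_trans hr; exact: (small _ _ s01 b01).1.
have i0 : 0 <= (0 : R) <= (1 : R) by rewrite lexx ler01.
have i1 : 0 <= (1 : R) <= (1 : R) by rewrite lexx ler01.
have dFs (s : R) : 0 <= s <= 1 -> is_derive s 1 F (dF s).
  move=> s01; rewrite /dF mulrBr.
  have [d1 e1] := nearx s 1 s01 i1; rewrite mul1r in d1 e1.
  have [d2 e2] := nearx s 0 s01 i0; rewrite mul0r scale0r addr0 in d2 e2.
  have D1 := is_derive_along_line f (x + h *: w) (h *: v) s d1.
  have D2 := is_derive_along_line f x (h *: v) s d2.
  have L y : differentiable f y -> 'D_(h *: v) f y = h * 'D_v f y.
    by move=> dy; rewrite !deriveE// linearZ.
  rewrite (L _ d1) e1 in D1; rewrite (L _ d2) e2 in D2.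
  exact: is_deriveB.
have [||s sI Fs] := @MVT R F dF 0 1 ltr01.
- by move=> s; rewrite in_itv/= => /andP[s0 s1]; apply: dFs; rewrite (ltW s0) (ltW s1).
- apply: derivable_within_continuous => s; rewrite in_itv/= => s01.
  by have [] := dFs s s01.
have s01 : 0 <= s <= 1 by move: sI; rewrite in_itv/= => /andP[/ltW-> /ltW->].
have -> : second_difference f x v w h =
    h * (p (x + h *: w + s *: (h *: v)) - p (x + s *: (h *: v))).
  rewrite -/(dF s) -[RHS]mulr1 -[X in _ * X]subr0 -Fs /F /second_difference.
  by rewrite !scale1r !scale0r !addr0 [x + _ + _]addrAC.
have [s1 s1'] := small s 1 s01 i1; rewrite !mul1r in s1 s1'.
have [s2 s2'] := small s 0 s01 i0; rewrite !mul0r scale0r !addr0 in s2 s2'.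
have P1 := pd ((s * h) *: v + h *: w).
have P2 := pd ((s * h) *: v).
rewrite -!ball_normE /ball_/= !sub0r !normrN in P1 P2.
have {}P1 := P1 (lt_trans s1 hd); have {}P2 := P2 (lt_trans s2 hd).
rewrite scalerA -addrA [h *: w + _]addrC.
set A := p (x + _) in P1 *; set B := p (x + (s * h) *: v) in P2 *.
rewrite deriveE//.
have -> : h * (A - B) - h ^+ 2 * 'd p x w = h *
    ((A - p x - 'd p x ((s * h) *: v + h *: w)) - (B - p x - 'd p x ((s * h) *: v))).
  by rewrite linearD linearZ/= [_ (h *: w)]linearZ/= /GRing.scale/=; ring.
rewrite normrM gtr0_norm// expr2 [eps * _]mulrCA ler_pM2l//.
apply: le_trans (ler_normB _ _) _; apply: le_trans (lerD P1 P2) _.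
rewrite -mulrDr mulrAC ler_pdivrMr// -mulrA ler_pM2l//.
apply: le_trans (lerD s1' s2') _.
rewrite -mulrDr ler_pM2l// /m; lra.
Unshelve. all: by end_near. Qed.

(** Young's theorem: the second difference is symmetric in [v] and [w], and both
    second derivatives are its limit after division by [h ^+ 2]. *)
Lemma derive_symmetric f p q x v w :
  (\forall y \near x, differentiable f y /\ 'D_v f y = p y) ->
  (\forall y \near x, differentiable f y /\ 'D_w f y = q y) ->
  differentiable p x -> differentiable q x -> 'D_w p x = 'D_v q x.
Proof.
move=> fp fq dp dq; apply/eqP; rewrite -subr_eq0 -normr_le0.
apply/ler_addgt0Pl => e e0; rewrite addr0.
have e20 : 0 < e / 2 by rewrite divr_gt0.
have A := second_difference_approx _ _ _ v w _ fp dp e20.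
have B := second_difference_approx _ _ _ w v _ fq dq e20.
near (0 : R)^'+ => h.
have h0 : 0 < h by near: h; exact: nbhs_right_gt.
have h20 : 0 < h ^+ 2 by rewrite exprn_gt0.
have Ah : `|second_difference f x v w h - h ^+ 2 * 'D_w p x| <= e / 2 * h ^+ 2.
  by near: h.
have Bh : `|second_difference f x w v h - h ^+ 2 * 'D_v q x| <= e / 2 * h ^+ 2.
  by near: h.
have sym : second_difference f x w v h = second_difference f x v w h.
  by rewrite /second_difference [x + _ + _]addrAC; ring.
rewrite sym in Bh.
rewrite -(ler_pM2r h20) -[X in _ * X <= _]gtr0_norm// -normrM.
set S := second_difference _ _ _ _ _ in Ah Bh.
have -> : ('D_w p x - 'D_v q x) * h ^+ 2 =
    (S - h ^+ 2 * 'D_v q x) - (S - h ^+ 2 * 'D_w p x) by ring.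
apply: le_trans (ler_normB _ _) _; apply: le_trans (lerD Bh Ah) _.
by rewrite -mulrDl -splitr.
Unshelve. all: by end_near. Qed.

End Young.

(** * Locally Lipschitz functions *)

Section LocalLipschitz.
Context {R : realType} {V : normedModType R}.
Implicit Types (p q : V -> R) (x : V).

Definition locally_lipschitz p x := exists L e : R, [/\ 0 <= L, 0 < e &
  forall y z, ball x e y -> ball x e z -> `|p y - p z| <= L * `|y - z|].

Lemma lipschitz_bounded p x : locally_lipschitz p x ->
  exists B e : R, [/\ 0 <= B, 0 < e & forall y, ball x e y -> `|p y| <= B].
Proof.
move=> [L [e [L0 e0 H]]]; exists (`|p x| + L * e), e.
split=> // [|y xy]; first by rewrite addr_ge0 ?mulr_ge0// ltW.
rewrite -[p y](subrK (p x)) addrC (le_trans (ler_normD _ _))// lerD2l.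
rewrite (le_trans (H _ _ xy (ballxx _ e0)))// ler_wpM2l// ltW//.
by move: xy; rewrite -ball_normE /ball_/= distrC.
Qed.

Lemma lipschitz_eq_near p q x : (\forall y \near x, p y = q y) ->
  locally_lipschitz p x -> locally_lipschitz q x.
Proof.
move=> /nbhs_ballP[/= r r0 pq] [L [e [L0 e0 H]]]; exists L, (Num.min e r).
split=> // [|y z xy xz]; first by rewrite lt_min e0.
have le t : ball x (Num.min e r) t -> ball x e t /\ ball x r t.
  by move=> xt; split; apply: le_ball xt; rewrite ge_min lexx ?orbT.
have [ye yr] := le _ xy; have [ze zr] := le _ xz.
by rewrite -(pq _ yr) -(pq _ zr) H.
Qed.

Lemma lipschitz_const (a : R) x : locally_lipschitz (fun=> a) x.
Proof.
exists 0, 1; split=> // y z _ _.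
by rewrite subrr normr0 mul0r.
Qed.

Lemma lipschitz_add p q x : locally_lipschitz p x -> locally_lipschitz q x ->
  locally_lipschitz (fun z => p z + q z) x.
Proof.
move=> [L [e [L0 e0 H]]] [L' [e' [L0' e0' H']]].
exists (L + L'), (Num.min e e').
split=> [||y z xy xz]; [exact: addr_ge0| by rewrite lt_min e0|].
have le t : ball x (Num.min e e') t -> ball x e t /\ ball x e' t.
  by move=> xt; split; apply: le_ball xt; rewrite ge_min lexx ?orbT.
have [ye ye'] := le _ xy; have [ze ze'] := le _ xz.
rewrite opprD addrACA (le_trans (ler_normD _ _))// mulrDl lerD//.
  exact: H.
exact: H'.
Qed.

Lemma lipschitz_mul p q x : locally_lipschitz p x -> locally_lipschitz q x ->
  locally_lipschitz (fun z => p z * q z) x.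
Proof.
move=> lp lq.
have [B [r [B0 r0 HB]]] := lipschitz_bounded _ _ lp.
have [B' [r' [B0' r0' HB']]] := lipschitz_bounded _ _ lq.
move: lp lq => [L [e [L0 e0 H]]] [L' [e' [L0' e0' H']]].
pose s := Num.min (Num.min e e') (Num.min r r').
exists (B * L' + B' * L), s.
split=> [||y z xy xz].
- by rewrite addr_ge0 ?mulr_ge0.
- by rewrite !lt_min e0 e0' r0.
have le t : ball x s t -> [/\ ball x e t, ball x e' t, ball x r t & ball x r' t].
  by move=> xt; split; apply: le_ball xt; rewrite !ge_min lexx ?orbT.
have [ye ye' yr _] := le _ xy; have [ze ze' _ zr'] := le _ xz.
have -> : p y * q y - p z * q z = p y * (q y - q z) + q z * (p y - p z) by ring.
rewrite (le_trans (ler_normD _ _))// !normrM mulrDl -!mulrA lerD// ler_pM//.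
- exact: HB.
- exact: H'.
- exact: HB'.
- exact: H.
Qed.

Lemma lipschitz_inv p x : p x != 0 -> locally_lipschitz p x ->
  locally_lipschitz (fun z => (p z)^-1) x.
Proof.
move=> px0 [L [e [L0 e0 H]]].
pose a := `|p x| / 2.
have a0 : 0 < a by rewrite divr_gt0 ?normr_gt0.
pose s := Num.min e (a / (L + 1)).
have s0 : 0 < s by rewrite lt_min e0 divr_gt0// ltr_wpDl.
have low y : ball x s y -> a <= `|p y|.
  move=> xy; have ye : ball x e y by apply: le_ball xy; rewrite ge_min lexx.
  have xys : `|x - y| < a / (L + 1).
    by move: xy; rewrite -ball_normE /ball_/= lt_min => /andP[].
  have : `|p x - p y| <= a.
    rewrite (le_trans (H _ _ (ballxx _ e0) ye))// (le_trans (ler_wpM2l L0 (ltW xys)))//.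
    by rewrite mulrCA ler_piMr ?(ltW a0)// ler_pdivrMr ?ltr_wpDl// mul1r lerDl.
  have := lerB_dist (p x) (p y); rewrite /a; lra.
exists (L / (a * a)), s; split=> //; first by rewrite divr_ge0// mulr_ge0 ?ltW.
move=> y z xy xz.
have [ye ze] : ball x e y /\ ball x e z.
  by split; [apply: le_ball xy|apply: le_ball xz]; rewrite ge_min lexx.
have py := low _ xy; have pz := low _ xz.
have py0 : p y != 0 by rewrite -normr_gt0 (lt_le_trans a0).
have pz0 : p z != 0 by rewrite -normr_gt0 (lt_le_trans a0).
have -> : (p y)^-1 - (p z)^-1 = (p z - p y) / (p y * p z).
  by field; rewrite py0 pz0.
rewrite normrM normfV normrM mulrAC ler_pM// ?invr_ge0 ?mulr_ge0//.
  by rewrite distrC; exact: H.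
rewrite lef_pV2 ?posrE ?mulr_gt0 ?normr_gt0//.
by rewrite ler_pM// ltW.
Qed.

Lemma lipschitz_sum (I : Type) (r : seq I) (P : pred I) (h : I -> V -> R) x :
  (forall i, locally_lipschitz (h i) x) ->
  locally_lipschitz (fun z => \sum_(i <- r | P i) h i z) x.
Proof.
move=> lh; elim: r => [|i r IH].
  under eq_fun do rewrite big_nil; exact: lipschitz_const.
under eq_fun do rewrite big_cons; case: (P i) => //.
exact: lipschitz_add.
Qed.

Lemma lipschitz_prod (I : Type) (r : seq I) (P : pred I) (h : I -> V -> R) x :
  (forall i, locally_lipschitz (h i) x) ->
  locally_lipschitz (fun z => \prod_(i <- r | P i) h i z) x.
Proof.
move=> lh; elim: r => [|i r IH].
  under eq_fun do rewrite big_nil; exact: lipschitz_const.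
under eq_fun do rewrite big_cons; case: (P i) => //.
exact: lipschitz_mul.
Qed.

Lemma lipschitz_det n (A : V -> 'M[R]_n) x :
  (forall i j, locally_lipschitz (fun z => A z i j) x) ->
  locally_lipschitz (fun z => \det (A z)) x.
Proof.
move=> lA; apply: lipschitz_sum => s; apply: lipschitz_mul; first exact: lipschitz_const.
by apply: lipschitz_prod => i.
Qed.

Lemma lipschitz_invmx n (A : V -> 'M[R]_n) x i j :
  (\forall z \near x, A z \in unitmx) ->
  (forall i j, locally_lipschitz (fun z => A z i j) x) ->
  locally_lipschitz (fun z => invmx (A z) i j) x.
Proof.
move=> uA lA.
apply: (@lipschitz_eq_near (fun z => (\det (A z))^-1 * cofactor (A z) j i)).
  near=> z; have uz : A z \in unitmx by near: z.
  by rewrite /invmx uz !mxE.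
apply: lipschitz_mul.
  apply: lipschitz_inv; last exact: lipschitz_det.
  by have := nbhs_singleton uA; rewrite unitmxE unitfE.
apply: lipschitz_mul; first exact: lipschitz_const.
apply: lipschitz_det => a b; under eq_fun do rewrite !mxE; exact: lA.
Unshelve. all: by end_near. Qed.

End LocalLipschitz.

Section SmoothLipschitz.
Context {R : realType} {n : nat}.
Local Notation V := 'rV[R]_n.

Lemma norm_entry_le {m k : nat} (A : 'M[R]_(m, k)) i j : `|A i j| <= `|A|.
Proof.
rewrite [leRHS]/Num.Def.normr/= mx_normrE.
exact: (le_bigmax _ (fun ij : 'I_m * 'I_k => `|A ij.1 ij.2|) (i, j)).
Qed.

(** A ball is convex, so the mean value theorem applies on the segment between two
    of its points; continuity of the partial derivatives at [x] bounds them on a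
    ball. *)
Lemma lipschitz_C1 (p : V -> R) x :
  (\forall y \near x, differentiable p y) ->
  (forall i, {for x, continuous (partial i p)}) ->
  locally_lipschitz p x.
Proof.
move=> dp cp.
have bp : \forall y \near x, differentiable p y /\
    forall i, `|partial i p y| <= `|partial i p x| + 1.
  near=> y; split; first by near: y.
  near: y; apply: filter_forall => i.
  have /cvgrPdist_lt /(_ 1 ltr01) := cp i; apply: filterS => y pxy.
  rewrite -[partial i p y](subrK (partial i p x)) addrC (le_trans (ler_normD _ _))//.
  by rewrite lerD2l distrC ltW.
have [/= e e0 H] := (nbhs_ballP _ _).1 bp.
pose L := \sum_i (`|partial i p x| + 1).
exists L, e; split=> //; first by apply: sumr_ge0 => i _; rewrite addr_ge0.
move=> y z xy xz.
have xs (s : R) : 0 <= s <= 1 -> ball x e (z + s *: (y - z)).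
  move=> /andP[s0 s1]; rewrite -ball_normE /ball_/=.
  have -> : x - (z + s *: (y - z)) = (1 - s) *: (x - z) + s *: (x - y).
    by rewrite !scalerBr !scalerBl !scale1r; apply/rowP => i; rewrite !mxE; ring.
  apply: le_lt_trans (ler_normD _ _) _; rewrite !normrZ !ger0_norm ?subr_ge0//.
  move: xy xz; rewrite -ball_normE /ball_/= => xy xz.
  have := mulr_ge0 s0 (normr_ge0 (x - y)).
  move: s0; rewrite le_eqVlt => /orP[/eqP<-|s0]; first by rewrite subr0 mul1r mul0r addr0.
  have : s * `|x - y| < s * e by rewrite ltr_pM2l.
  have : (1 - s) * `|x - z| <= (1 - s) * e by rewrite ler_wpM2l ?subr_ge0// ltW.
  lra.
have D (s : R) : 0 <= s <= 1 ->
    is_derive s 1 (fun s : R => p (z + s *: (y - z))) ('D_(y - z) p (z + s *: (y - z))).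
  by move=> s01; apply: is_derive_along_line; have [] := H _ (xs s s01).
have [||s sI] := @MVT R (fun s : R => p (z + s *: (y - z)))
    (fun s => 'D_(y - z) p (z + s *: (y - z))) 0 1 ltr01.
- by move=> s; rewrite in_itv/= => /andP[s0 s1]; apply: D; rewrite (ltW s0) (ltW s1).
- apply: derivable_within_continuous => s; rewrite in_itv/= => s01.
  by have [] := D s s01.
have s01 : 0 <= s <= 1 by move: sI; rewrite in_itv/= => /andP[/ltW-> /ltW->].
rewrite scale1r scale0r addr0 [z + _]addrC subrK subr0 mulr1 => ->.
have [ds bs] := H _ (xs s s01).
rewrite [X in 'D_X _ _]row_sum_delta derive_linear_comb// mulr_suml.
rewrite (le_trans (ler_norm_sum _ _ _))//; apply: ler_sum => i _.
rewrite normrZ mulrC ler_pM//; first exact: bs.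
exact: norm_entry_le.
Unshelve. all: by end_near. Qed.

Lemma smooth_on_entry_lipschitz {m k : nat} (U : set V) (A : V -> 'M[R]_(m, k)) x i j :
  open U -> U x -> smooth_on U A -> locally_lipschitz (fun y => A y i j) x.
Proof.
move=> oU Ux sA.
have nU : \forall y \near x, U y by exact: open_nbhs_nbhs.
apply: lipschitz_C1.
  by apply: filterS nU => y Uy; exact: (differentiable_mxP A y).1 (sA [::] y Uy) i j.
move=> l; have c : {for x, continuous (fun y => ('D_(delta_mx 0 l) A y) i j)}.
  apply: differentiable_continuous.
  exact: (differentiable_mxP _ x).1 (sA [:: delta_mx 0 l] x Ux) i j.
have E : \forall y \near x, ('D_(delta_mx 0 l) A y) i j = partial l (fun y => A y i j) y.
  apply: filterS nU => y Uy; rewrite derive_coord//.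
  exact/diff_derivable/(sA [::]).
move: c; rewrite /prop_for /continuous_at (nbhs_singleton E) => c.
exact: (cvg_trans (near_eq_cvg E) c).
Qed.

Lemma smooth_on_derive {W : normedModType R} (U : set V) (A : V -> W) v :
  smooth_on U A -> smooth_on U ('D_v A).
Proof.
by move=> sA vs x Ux; have := sA (rcons vs v) x Ux; rewrite foldr_rcons.
Qed.

(** The inverse of the metric is a quotient of determinants, so that the algebra of
    locally Lipschitz functions contains the Christoffel symbols. *)
Lemma christoffel_lipschitz (U : set V) (g : V -> 'M[R]_n) x k i j :
  open U -> U x -> smooth_on U g -> (forall y, U y -> g y \in unitmx) ->
  locally_lipschitz (fun y => christoffel g y k i j) x.
Proof.
move=> oU Ux sg ug.
have nU : \forall y \near x, U y by exact: open_nbhs_nbhs.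
have le a b := smooth_on_entry_lipschitz U g x a b oU Ux sg.
have lp l a b : locally_lipschitz (partial l (fun y => g y a b)) x.
  apply: lipschitz_eq_near (smooth_on_entry_lipschitz U _ x a b oU Ux
    (smooth_on_derive _ _ (delta_mx 0 l) sg)).
  apply: filterS nU => y Uy; rewrite derive_coord//.
  exact/diff_derivable/(sg [::]).
apply: lipschitz_mul; first exact: lipschitz_const.
apply: lipschitz_sum => l; apply: lipschitz_mul.
  by apply: lipschitz_invmx => //; apply: filterS nU => y; exact: ug.
have minus := lipschitz_mul _ _ _ (lipschitz_const (-1) x) (lp l i j).
apply: (lipschitz_eq_near _ _ _ _
  (lipschitz_add _ _ _ (lipschitz_add _ _ _ (lp i j l) (lp j i l)) minus)).
by near=> y; rewrite mulN1r.
Unshelve. all: by end_near. Qed.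

End SmoothLipschitz.

(* Unification must not compare derivatives by unfolding them to limits. *)
#[local] Opaque derive derive1.

(** * Local isometries and geodesics *)

Section InnerDerivative.
Context {R : realType} {n : nat}.
Local Notation V := 'rV[R]_n.

Lemma is_derive_bigsum {W : normedModType R} (m : nat) (p : 'I_m -> W -> R) dp x v :
  (forall i, is_derive x v (p i) (dp i)) ->
  is_derive x v (fun z => \sum_i p i z) (\sum_i dp i).
Proof.
move=> H; rewrite (_ : (fun z => _) = \sum_i p i); first exact: is_derive_sum.
by apply/funext => z; rewrite fct_sumE.
Qed.

Lemma is_derive_entry {W : normedModType R} {m k : nat} (A : W -> 'M[R]_(m, k)) x v i j :
  differentiable A x -> is_derive x v (fun y => A y i j) (('D_v A x) i j).
Proof.
move=> dA; have dv : derivable A x v by exact: diff_derivable.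
rewrite derive_coord//; apply: derivableP.
exact/diff_derivable/(differentiable_mxP A x).1.
Qed.

Lemma derivable_entry {W : normedModType R} {m k : nat} (A : W -> 'M[R]_(m, k)) x v i j :
  derivable A x v -> derivable (fun y => A y i j) x v.
Proof. by move=> /derivable_mxP. Qed.

Lemma derive_comp {W : normedModType R} (p : V -> W) (G : V -> V) x v :
  differentiable G x -> differentiable p (G x) ->
  'D_v (p \o G) x = 'D_('D_v G x) p (G x).
Proof.
move=> dG dp; rewrite deriveE; last exact: differentiable_comp.
by rewrite diff_comp//= -!deriveE.
Qed.

Lemma derive1_comp_curve (f : V -> V) (c : R -> V) (t : R) :
  derivable c t 1 -> differentiable f (c t) ->
  derive1 (f \o c) t = 'D_(derive1 c t) f (c t).
Proof. by move=> dc df; rewrite !derive1E; exact: derive_comp_curve. Qed.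

Lemma derive_row_sum (f : V -> V) x (u : V) : differentiable f x ->
  'D_u f x = \sum_i u 0 i *: 'D_(delta_mx 0 i) f x.
Proof.
move=> df; rewrite [X in 'D_X _ _]row_sum_delta; exact: derive_linear_comb.
Qed.

Lemma derive_inner_comp (h : V -> 'M[R]_n) (G A B : V -> V) x w :
  differentiable G x -> differentiable A x -> differentiable B x ->
  differentiable h (G x) ->
  'D_w (fun y => inner h (G y) (A y) (B y)) x =
  'D_('D_w G x) (fun z => inner h z (A x) (B x)) (G x)
  + inner h (G x) ('D_w A x) (B x) + inner h (G x) (A x) ('D_w B x).
Proof.
move=> dG dA dB dh.
have dhG : differentiable (h \o G) x by exact: differentiable_comp.
have eh : 'D_w (h \o G) x = 'D_('D_w G x) h (G x) by exact: derive_comp.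
under eq_fun do rewrite innerE.
have -> : 'D_('D_w G x) (fun z => inner h z (A x) (B x)) (G x) =
    \sum_i \sum_j (A x 0 i * B x 0 j) * ('D_('D_w G x) h (G x)) i j.
  under eq_fun do rewrite innerE.
  apply: derive_of; apply: is_derive_bigsum => i; apply: is_derive_bigsum => j.
  notypeclasses refine (is_derive_congr _ _ _ _ _ _ _).
    notypeclasses refine (is_derive_mul (fun=> A x 0 i * B x 0 j)
      (fun z => h z i j) _ _ _ _ _ _); first exact: is_derive_const.
    exact: is_derive_entry.
  by rewrite mulr0 addr0.
rewrite !innerE -!big_split/=.
apply: derive_of; apply: is_derive_bigsum => i.
rewrite -!big_split/=; apply: is_derive_bigsum => j.
notypeclasses refine (is_derive_congr _ _ _ _ _ _ _).
  notypeclasses refine (is_derive_mul (fun y => A y 0 i * B y 0 j)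
    (fun y => h (G y) i j) _ _ _ _ _ _).
    by notypeclasses refine (is_derive_mul (fun y => A y 0 i) (fun y => B y 0 j)
      _ _ _ _ _ _); exact: is_derive_entry.
  exact: (is_derive_entry (h \o G)).
by rewrite eh /=; ring.
Qed.

End InnerDerivative.

Section LocalIsometry.
Context {R : realType} {n : nat}.
Local Notation V := 'rV[R]_n.
Variables (g h : V -> 'M[R]_n) (G : V -> V) (U W : set V).
Hypotheses (oU : open U) (oW : open W) (UW : forall x, U x -> W (G x)).
Hypotheses (sG : smooth_on U G) (sg : smooth_on U g) (sh : smooth_on W h).
Hypotheses (gs : forall x, U x -> (g x)^T = g x) (gu : forall x, U x -> g x \in unitmx).
Hypotheses (hs : forall x, W x -> (h x)^T = h x) (hu : forall x, W x -> h x \in unitmx).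
Hypothesis isom : forall x, U x -> g x = 'J G x *m h (G x) *m ('J G x)^T.

Let nearU x : U x -> \forall y \near x, U y.
Proof. by move=> Ux; exact: open_nbhs_nbhs. Qed.

Let dG x : U x -> differentiable G x. Proof. exact: (sG [::]). Qed.

Let dDG v x : U x -> differentiable ('D_v G) x. Proof. exact: (sG [:: v]). Qed.

#[local] Hint Extern 0 (differentiable G _) => (solve [apply: dG; assumption]) : core.
#[local] Hint Extern 0 (differentiable (derive G ^~ _) _) =>
  (solve [apply: dDG; assumption]) : core.

Lemma isometry_inner x u v : U x ->
  inner g x u v = inner h (G x) ('D_u G x) ('D_v G x).
Proof.
move=> Ux; rewrite !deriveEjacobian// /inner. rewrite isom// trmx_mul.
by rewrite !mulmxA.
Qed.

Lemma isometry_jacobian_unit x : U x -> 'J G x \in unitmx.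
Proof. by move=> Ux; have := gu x Ux; rewrite isom// !unitmx_mul => /andP[/andP[]]. Qed.

Lemma derive_derive_symmetric x u v : U x -> 'D_v ('D_u G) x = 'D_u ('D_v G) x.
Proof.
move=> Ux.
have nU := nearU x Ux.
apply/rowP => i.
rewrite [LHS]derive_coord; last exact/diff_derivable/dDG.
rewrite [RHS]derive_coord; last exact/diff_derivable/dDG.
have N w : \forall y \near x, differentiable (fun z => G z 0 i) y /\
    'D_w (fun z => G z 0 i) y = ('D_w G y) 0 i.
  apply: filterS nU => y Uy; split; first exact: (differentiable_mxP G y).1 (dG y Uy) 0 i.
  by rewrite derive_coord//; exact/diff_derivable/dG.
apply: (derive_symmetric (fun z => G z 0 i)) (N u) (N v) _ _.
  exact: (differentiable_mxP _ x).1 (dDG u x Ux) 0 i.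
exact: (differentiable_mxP _ x).1 (dDG v x Ux) 0 i.
Qed.

(** The Koszul formula is natural under isometries: the second derivatives of
    the map cancel by their symmetry, except for one. *)
Lemma christoffel_isometry x u : U x ->
  'D_u ('D_u G) x + christoffel_form h (G x) ('D_u G x) ('D_u G x) =
  christoffel_form g x u u *m 'J G x.
Proof.
move=> Ux; have Wx := UW x Ux.
apply: (inner_nondegenerate h (G x)); first exact: hu.
move=> w; pose l := w *m invmx ('J G x).
have -> : w = 'D_l G x.
  by rewrite deriveEjacobian// mulmxKV// isometry_jacobian_unit.
rewrite -deriveEjacobian// -isometry_inner//.
have dgx : differentiable g x by exact: (sg [::]).
have dhx : differentiable h (G x) by exact: (sh [::]).
rewrite inner_christoffel//; [|exact: gs|exact: gu].
have E a b c : 'D_c (fun y => inner g y a b) x =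
    'D_('D_c G x) (fun z => inner h z ('D_a G x) ('D_b G x)) (G x)
    + inner h (G x) ('D_c ('D_a G) x) ('D_b G x)
    + inner h (G x) ('D_a G x) ('D_c ('D_b G) x).
  refine (etrans _ (derive_inner_comp h G ('D_a G) ('D_b G) x c (dG x Ux)
    (dDG a x Ux) (dDG b x Ux) dhx)).
  apply: near_eq_derive; apply: filterS (nearU x Ux) => y Uy.
  exact: isometry_inner.
have addl p q r : inner h (G x) (p + q) r = inner h (G x) p r + inner h (G x) q r.
  by rewrite /inner !mulmxDl mxE.
rewrite (E u l u) (E u u l) addl.
rewrite inner_christoffel; [|exact: dhx|exact: hs|exact: hu].
have arith (p q a b c d : R) : c = b -> d = b ->
    2^-1 * (p + a + b + (p + a + b) - (q + c + d)) = a + 2^-1 * (p + p - q).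
  by move=> -> ->; field.
have S := derive_derive_symmetric x u l Ux.
apply: esym; apply: arith; last exact: (congr1 (inner h (G x) (derive G x u)) S).
refine (etrans (congr1 (fun z => inner h (G x) z ('D_u G x)) S) _).
by apply: innerC; exact: hs.
Qed.

Definition coordinate_geodesic (m : V -> 'M[R]_n) (c : R -> V) (t : R) : Prop :=
  [/\ \forall s \near t, derivable c s 1, derivable (derive1 c) t 1 &
      derive1n 2 c t + christoffel_form m (c t) (derive1 c t) (derive1 c t) = 0].

Lemma derive_bigsum_curve (p : 'I_n -> R -> R) (E : 'I_n -> R -> V) t :
  (forall i, derivable (p i) t 1) -> (forall i, derivable (E i) t 1) ->
  is_derive t 1 (fun s => \sum_i p i s *: E i s)
    (\sum_i (p i t *: 'D_1 (E i) t + 'D_1 (p i) t *: E i t)).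
Proof.
move=> dp dE; apply: is_derive_mxP => a b.
rewrite summxE; under eq_fun do rewrite summxE.
apply: is_derive_bigsum => i; rewrite 3!mxE.
under eq_fun do rewrite mxE.
notypeclasses refine (is_derive_congr _ _ _ _ _ _ _).
  notypeclasses refine (is_derive_mul (p i) (fun s => E i s a b) _ _ _ _ _ _).
    exact: derivableP.
  by apply: derivableP; exact: derivable_entry.
by rewrite derive_coord// [X in _ + X = _]mulrC.
Qed.

(** The second derivative of [G o c] is [D_{c''} G + D_{c'} D_{c'} G], and
    [christoffel_isometry] turns its geodesic curvature into the image of that of
    [c]. *)
Lemma isometry_geodesic c t : U (c t) -> coordinate_geodesic g c t ->
  coordinate_geodesic h (G \o c) t /\ derive1 (G \o c) t = 'D_(derive1 c t) G (c t).
Proof.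
move=> Uc [dc ddc geo].
have dct : derivable c t 1 by exact: nbhs_singleton dc.
have cc : {for t, continuous c} by exact/differentiable_continuous/derivable1_diffP.
have nU : \forall s \near t, U (c s) /\ derivable c s 1.
  by near=> s; split; near: s => //; apply: cc; exact: nearU.
have D1 : \forall s \near t, derivable (G \o c) s 1 /\
    derive1 (G \o c) s = \sum_i (derive1 c s) 0 i *: 'D_(delta_mx 0 i) G (c s).
  apply: filterS nU => s [Us ds].
  have [d _] := is_derive_comp_curve G c s _ (derivableP ds) (dG _ Us).
  split=> //; refine (etrans (derive1_comp_curve G c s ds (dG _ Us)) _).
  exact/derive_row_sum/dG.
have dp i : derivable (fun s => (derive1 c s) 0 i) t 1.
  exact: derivable_entry.
have DE i : is_derive t 1 ('D_(delta_mx 0 i) G \o c)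
    ('D_(derive1 c t) ('D_(delta_mx 0 i) G) (c t)).
  rewrite derive1E; apply: is_derive_comp_curve; first exact: derivableP.
  exact: dDG.
have dDE i : derivable ('D_(delta_mx 0 i) G \o c) t 1 by case: (DE i).
have D2 := derive_bigsum_curve (fun i s => (derive1 c s) 0 i)
  (fun i => 'D_(delta_mx 0 i) G \o c) t dp dDE.
have Geq : \forall s \near t, \sum_i (derive1 c s) 0 i *: ('D_(delta_mx 0 i) G \o c) s =
    derive1 (G \o c) s by apply: filterS D1 => s [_ ->].
have [D2d D2e] := near_eq_is_derive Geq D2.
have E1 := derive1_comp_curve G c t dct (dG _ Uc).
split; last exact: E1.
split; [by apply: filterS D1 => s [] | exact: D2d | ].
set u := derive1 c t.
have E2 : derive1 (derive1 (G \o c)) t =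
    'D_(derive1 (derive1 c) t) G (c t) + 'D_u ('D_u G) (c t).
  refine (etrans (derive1E _ _) (etrans D2e _)).
  rewrite big_split/= addrC; congr (_ + _).
    refine (esym (etrans (derive_row_sum _ _ _ (dG _ Uc)) _)).
    apply: eq_bigr => i _; congr (_ *: _).
    refine (etrans (congr1 (fun z : V => z 0 i) (derive1E _ _)) _).
    exact: derive_coord.
  have F1 : 'D_u ('D_u G) (c t) =
      'D_u (\sum_i fun y => u 0 i *: 'D_(delta_mx 0 i) G y) (c t).
    apply: near_eq_derive; apply: filterS (nearU _ Uc) => y Uy.
    by rewrite fct_sumE; exact/derive_row_sum/dG.
  have F2 : 'D_u (\sum_i fun y => u 0 i *: 'D_(delta_mx 0 i) G y) (c t) =
      \sum_i 'D_u (fun y => u 0 i *: 'D_(delta_mx 0 i) G y) (c t).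
    by apply: derive_sum => i; exact/derivableZ/diff_derivable/dDG.
  refine (esym (etrans F1 (etrans F2 _))).
  apply: eq_bigr => i _.
  refine (etrans (deriveZ _ _) _); first exact/diff_derivable/dDG.
  exact: (esym (congr1 (fun z : V => u 0 i *: z) (derive_of _ _ _ _ (DE i)))).
refine (etrans (congr2 (fun a b : V => a + christoffel_form h (G (c t)) b b) E2 E1) _).
rewrite -addrA; refine (etrans (congr1 (+%R _) (christoffel_isometry (c t) u Uc)) _).
rewrite deriveEjacobian; last exact: dG.
by rewrite -mulmxDl [X in X *m _]geo mul0mx.
Unshelve. all: by end_near. Qed.

End LocalIsometry.

(** * Comparison of solutions of second-order equations *)

Section Comparison.
Context {R : realType} {n : nat}.
Local Notation V := 'rV[R]_n.

Definition sqdist (x y v w : V) : R :=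
  \sum_i ((x 0 i - y 0 i) * (x 0 i - y 0 i) + (v 0 i - w 0 i) * (v 0 i - w 0 i)).

Lemma sqdist_ge (x y v w : V) i :
  (x 0 i - y 0 i) ^+ 2 <= sqdist x y v w /\ (v 0 i - w 0 i) ^+ 2 <= sqdist x y v w.
Proof.
rewrite /sqdist (bigD1 i)//=; set S := \sum_(j | _) _.
have S0 : 0 <= S by apply: sumr_ge0 => j _; rewrite addr_ge0// -expr2 sqr_ge0.
have := sqr_ge0 (x 0 i - y 0 i); have := sqr_ge0 (v 0 i - w 0 i).
rewrite !expr2; split; lra.
Qed.

Lemma norm_rV_sqr_le (x : V) (E : R) : 0 <= E ->
  (forall i, (x 0 i) ^+ 2 <= E) -> `|x| ^+ 2 <= E.
Proof.
move=> E0 xE; have [->|x0] := eqVneq (`|x|) 0; first by rewrite expr0n.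
have [[i j] xij] := mx_norm_neq0 x0.
rewrite (xij : `|x| = `|x i j|).
by rewrite real_normK ?num_real//= (ord1 i).
Qed.

Lemma sqdist_norm (x y v w : V) : `|(x, v) - (y, w)| ^+ 2 <= sqdist x y v w.
Proof.
have S0 : 0 <= sqdist x y v w.
  by apply: sumr_ge0 => j _; rewrite addr_ge0// -expr2 sqr_ge0.
have xy : `|x - y| ^+ 2 <= sqdist x y v w.
  by apply: norm_rV_sqr_le => // i; rewrite !mxE; have [] := sqdist_ge x y v w i.
have vw : `|v - w| ^+ 2 <= sqdist x y v w.
  by apply: norm_rV_sqr_le => // i; rewrite !mxE; have [] := sqdist_ge x y v w i.
by rewrite prod_normE /=; case: (leP `|x - y| `|v - w|).
Qed.

(** Gronwall's inequality, read backwards in time, for the difference of two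
    solutions of a second-order equation with Lipschitz right-hand side: the
    squared distance [E] satisfies [E' >= - C E], so that [exp (C s) E s] does not
    decrease. *)
Lemma second_order_comparison (a : V * V -> V) (L : R) (B : set (V * V))
    (x v y w : R -> V) (t t1 : R) :
  0 <= L ->
  (forall z z' i, B z -> B z' -> `|a z 0 i - a z' 0 i| <= L * `|z - z'|) ->
  t <= t1 ->
  (forall s, t <= s <= t1 -> [/\ B (x s, v s), is_derive s 1 x (v s) &
      is_derive s 1 v (a (x s, v s))]) ->
  (forall s, t <= s <= t1 -> [/\ B (y s, w s), is_derive s 1 y (w s) &
      is_derive s 1 w (a (y s, w s))]) ->
  sqdist (x t) (y t) (v t) (w t) <=
  expR (2 * n%:R * (1 + L) * (t1 - t)) * sqdist (x t1) (y t1) (v t1) (w t1).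
Proof.
move=> L0 La; rewrite le_eqVlt => /orP[/eqP <-|tt1] Hx Hy.
  by rewrite subrr mulr0 expR0 mul1r.
pose C : R := 2 * n%:R * (1 + L).
pose E s := sqdist (x s) (y s) (v s) (w s).
pose dE s : R := \sum_i (2 * (x s 0 i - y s 0 i) * (v s 0 i - w s 0 i)
  + 2 * (v s 0 i - w s 0 i) * (a (x s, v s) 0 i - a (y s, w s) 0 i)).
have entry (c : R -> V) (d : V) (s : R) (i : 'I_n) :
    is_derive s 1 c d -> is_derive s 1 (fun s => c s 0 i) (d 0 i).
  move=> [dc <-]; rewrite derive_coord//; apply: derivableP.
  exact: derivable_entry.
have DE s : t <= s <= t1 -> is_derive s 1 E (dE s).
  move=> st; have [_ dx dv] := Hx s st; have [_ dy dw] := Hy s st.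
  apply: is_derive_bigsum => i.
  have X := entry _ _ _ i dx; have Y := entry _ _ _ i dy.
  have V' := entry _ _ _ i dv; have W := entry _ _ _ i dw.
  have D1 := is_derive_sub _ _ _ _ _ _ X Y.
  have D2 := is_derive_sub _ _ _ _ _ _ V' W.
  have D := is_derive_add _ _ _ _ _ _ (is_derive_mul _ _ _ _ _ _ D1 D1)
    (is_derive_mul _ _ _ _ _ _ D2 D2).
  notypeclasses refine (is_derive_congr _ _ _ _ _ D _).
  by rewrite /=; ring.
have dE_ge s : t <= s <= t1 -> - (C * E s) <= dE s.
  move=> st; have [Bx _ _] := Hx s st; have [By _ _] := Hy s st.
  rewrite lerNl; apply: le_trans (ler_norm _) _; rewrite normrN.
  apply: le_trans (ler_norm_sum _ _ _) _.
  have -> : C * E s = \sum_(i < n) (2 * (1 + L) * E s).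
    by rewrite sumr_const card_ord -mulr_natr /C; ring.
  apply: ler_sum => i _; rewrite -!mulrA -mulrDr normrM ger0_norm// ler_pM2l//.
  pose N := `|(x s, v s) - (y s, w s)|.
  have NE : N ^+ 2 <= E s := sqdist_norm _ _ _ _.
  have N0 : 0 <= N by exact: normr_ge0.
  have xN : `|x s 0 i - y s 0 i| <= N.
    rewrite /N prod_normE /= le_max; apply/orP; left.
    by have := norm_entry_le (x s - y s) 0 i; rewrite !mxE.
  have vN : `|v s 0 i - w s 0 i| <= N.
    rewrite /N prod_normE /= le_max; apply/orP; right.
    by have := norm_entry_le (v s - w s) 0 i; rewrite !mxE.
  have aN := La _ _ i Bx By; rewrite -/N in aN.
  apply: le_trans (ler_normD _ _) _; rewrite !normrM.
  apply: (@le_trans _ _ (N * N + N * (L * N))).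
    by rewrite lerD// ler_pM.
  by apply: (@le_trans _ _ ((1 + L) * N ^+ 2)); [rewrite expr2; lra | rewrite ler_wpM2l ?addr_ge0].
pose H s := expR (C * s) * E s.
pose dH s := expR (C * s) * dE s + E s * (C * expR (C * s)).
have DH s : t <= s <= t1 -> is_derive s 1 H (dH s).
  move=> st; apply: is_derive_mul; last exact: DE.
  have dl : is_derive s 1 (fun s : R => C * s) C.
    notypeclasses refine (is_derive_congr _ _ _ _ _
      (is_derive_mul _ _ _ _ _ _ (is_derive_const C s 1) (is_derive_id s 1)) _).
    by rewrite mulr0 addr0 mulr1.
  have D := is_derive1_comp (is_derive_expR (C * s)) dl.
  by notypeclasses refine (is_derive_congr _ _ _ _ _ D _); rewrite mulrC.
have [||s sI] := @MVT R H dH t t1 tt1.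
- by move=> s; rewrite in_itv/= => /andP[s0 s1]; apply: DH; rewrite (ltW s0) (ltW s1).
- apply: derivable_within_continuous => s; rewrite in_itv/= => st.
  by have [] := DH s st.
have st : t <= s <= t1 by move: sI; rewrite in_itv/= => /andP[/ltW-> /ltW->].
have dH0 : 0 <= dH s.
  have -> : dH s = expR (C * s) * (dE s + C * E s) by rewrite /dH; ring.
  by rewrite mulr_ge0 ?expR_ge0//; have := dE_ge s st; lra.
move=> Ht; have : H t <= H t1 by rewrite -subr_ge0 Ht mulr_ge0// subr_ge0 ltW.
rewrite /H -/C -/(E t) -/(E t1) mulrBr expRD expRN.
by rewrite -ler_pdivlMl ?expR_gt0// mulrA [_^-1 * _]mulrC.
Qed.

End Comparison.



Section Growth.
Context {R : realType}.

Lemma cvg_bigsum {T : Type} {V : normedModType R} (F : set_system T) {FF : Filter F}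
    (m : nat) (p : 'I_m -> T -> V) (l : 'I_m -> V) :
  (forall i, p i z @[z --> F] --> l i) ->
  (\sum_i p i z) @[z --> F] --> \sum_i l i.
Proof.
move=> H; elim: (index_enum _) => [|i r IH].
  by rewrite big_nil; under eq_fun do rewrite big_nil; exact: cvg_cst.
by rewrite big_cons; under eq_fun do rewrite big_cons; apply: cvgD; [exact: H|exact: IH].
Qed.

Lemma derivable_continuous {V : normedModType R} (p : R -> V) t :
  derivable p t 1 -> {for t, continuous p}.
Proof. by move=> dp; exact/differentiable_continuous/derivable1_diffP. Qed.

Lemma derivable_growth {V : normedModType R} (p : R -> V) c0 : derivable p c0 1 ->
  exists K : R, 0 <= K /\ \forall c \near c0, `|p c - p c0| <= K * `|c - c0|.
Proof.
move=> /cvg_ex[/= l pl]; exists (`|l| + 1); split; first by rewrite addr_ge0.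
have /cvgrPdist_lt /(_ 1 ltr01) := pl; rewrite near_withinE => H.
rewrite (near_shift 0 c0).
near=> h; rewrite /= subr0 addrK.
have [->|h0] := eqVneq h 0; first by rewrite add0r subrr !normr0 mulr0.
have : `|l - h^-1 *: (p (h *: 1 + c0) - p c0)| < 1.
  by move: h0; near: h.
rewrite [h *: 1]mulr1 => lt1.
have -> : p (h + c0) - p c0 = h *: (h^-1 *: (p (h + c0) - p c0)).
  by rewrite scalerA mulfV// scale1r.
rewrite normrZ mulrC ler_wpM2r//.
rewrite -[_^-1 *: _](subrK l) addrC (le_trans (ler_normD _ _))// lerD2l distrC.
exact: ltW.
Unshelve. all: by end_near. Qed.

(** A quadratic bound on increments passes to the derivative in the limit, as the
    square of the difference quotient is at most [K]. *)
Lemma derive_sqr_le (p : R -> R) c0 (K : R) : derivable p c0 1 ->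
  (\forall c \near c0, (p c - p c0) ^+ 2 <= K * (c - c0) ^+ 2) ->
  ('D_1 p c0) ^+ 2 <= K.
Proof.
move=> dp H.
pose q h : R := h^-1 *: (p (h *: 1 + c0) - p c0).
have ql : q h @[h --> 0^'] --> 'D_1 p c0 by exact: dp.
have qql : (q h * q h) @[h --> 0^'] --> 'D_1 p c0 * 'D_1 p c0 by exact: cvgM.
rewrite expr2 -(cvg_lim _ qql)//; apply: limr_le; first by apply/cvg_ex; eexists; exact: qql.
rewrite near_withinE; move: H; rewrite (near_shift 0 c0) => H.
near=> h => h0.
have : (p (h + c0) - p c0) ^+ 2 <= K * h ^+ 2.
  have -> : h ^+ 2 = (h + c0 - c0) ^+ 2 by rewrite addrK.
  have : (p (h + (c0 - 0)) - p c0) ^+ 2 <= K * (h + (c0 - 0) - c0) ^+ 2 by near: h.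
  by rewrite subr0.
move=> Hh; rewrite /q [h *: 1]mulr1 /GRing.scale/= mulrACA -invfM -!expr2 mulrC.
by rewrite ler_pdivrMr// exprn_even_gt0.
Unshelve. all: by end_near. Qed.

End Growth.

(** * Variations of geodesics under embeddings in complete manifolds *)

Section GeodesicVariation.
Context {R : realType} {n : nat}.
Local Notation V := 'rV[R]_n.
Variables (g h : V -> 'M[R]_n) (G : V -> V) (U W : set V).
Hypotheses (oU : open U) (oW : open W) (UW : forall x, U x -> W (G x)).
Hypotheses (sG : smooth_on U G) (sg : smooth_on U g) (sh : smooth_on W h).
Hypotheses (gs : forall x, U x -> (g x)^T = g x) (gu : forall x, U x -> g x \in unitmx).
Hypotheses (hs : forall x, W x -> (h x)^T = h x) (hu : forall x, W x -> h x \in unitmx).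
Hypothesis isom : forall x, U x -> g x = 'J G x *m h (G x) *m ('J G x)^T.
Variables (Phi Psi : R -> R -> V) (c0 : R).

Let X c t : V := G (Phi c t).
Let Y c t : V := 'D_(Psi c t) G (Phi c t).
Let nearU x : U x -> \forall y \near x, U y.
Proof. by move=> Ux; exact: open_nbhs_nbhs. Qed.
Let dG x : U x -> differentiable G x. Proof. exact: (sG [::]). Qed.
Let dDG v x : U x -> differentiable ('D_v G) x. Proof. exact: (sG [:: v]). Qed.

Definition geodesic_equations (m : V -> 'M[R]_n) (x v : R -> V) (s : R) : Prop :=
  is_derive s 1 x (v s) /\ is_derive s 1 v (- christoffel_form m (x s) (v s) (v s)).

Lemma geodesic_equations_geodesic m x v t :
  (\forall s \near t, geodesic_equations m x v s) ->
  coordinate_geodesic m x t /\ derive1 x t = v t.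
Proof.
move=> H.
have [[dx ex] [dv ev]] := nbhs_singleton H.
have E : \forall s \near t, v s = derive1 x s.
  by apply: filterS H => s [[_ es] _]; rewrite derive1E es.
have [d2 e2] := near_eq_is_derive E (DeriveDef dv ev).
have e1 : derive1 x t = v t by rewrite derive1E.
split=> //; split; [by apply: filterS H => s [[]] | exact: d2 | ].
refine (etrans (congr2 (fun a b : V => a + christoffel_form m (x t) b b)
  (etrans (derive1E (derive1 x) t) e2) e1) _).
exact: addNr.
Qed.

Lemma pushed_equations c t :
  (\forall s \near t, geodesic_equations g (Phi c) (Psi c) s) -> U (Phi c t) ->
  geodesic_equations h (X c) (Y c) t.
Proof.
move=> H Ut.
have [[dx _] _] := nbhs_singleton H.
have cx : {for t, continuous (Phi c)}.
  exact: (derivable_continuous (Phi c) t dx).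
have nUt : \forall s \near t, U (Phi c s) by apply: cx; exact: nearU.
have near1 : \forall s \near t, derivable (X c) s 1 /\ derive1 (X c) s = Y c s.
  apply: filterS (filterI H nUt) => s [[[ds es] _] Us]; split.
    exact: (ex_derive (is_derive := is_derive_comp_curve G (Phi c) s _ (derivableP ds) (dG _ Us))).
  refine (etrans (derive1_comp_curve G (Phi c) s ds (dG _ Us)) _).
  by rewrite derive1E es.
have [geo e1] := geodesic_equations_geodesic g (Phi c) (Psi c) t H.
have [[_ d2 geoX] _] := isometry_geodesic g h G U W oU UW sG sg sh gs gu hs hu isom
  (Phi c) t Ut geo.
have [d1 eX] := nbhs_singleton near1.
split; first exact: (DeriveDef d1 (etrans (esym (derive1E _ _)) eX)).
have E : \forall s \near t, derive1 (X c) s = Y c s by apply: filterS near1 => s [].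
apply: (near_eq_is_derive E); apply: DeriveDef; first exact: d2.
refine (etrans (esym (derive1E _ _)) _).
have /eqP := geoX; rewrite addr_eq0 => /eqP geoX'.
exact: (etrans geoX' (congr1 (fun b : V => - christoffel_form h (X c t) b b) eX)).
Qed.

Let YE c t : U (Phi c t) -> Y c t =
  \sum_i Psi c t 0 i *: 'D_(delta_mx 0 i) G (Phi c t).
Proof. by move=> Ut; exact/derive_row_sum/dG. Qed.

(** Continuity in both variables is what makes the images of nearby geodesics stay
    in a given open set during a whole compact interval of time. *)
Lemma pushed_continuous t :
  {for (t, c0), continuous (fun z : R * R => Phi z.2 z.1)} ->
  {for (t, c0), continuous (fun z : R * R => Psi z.2 z.1)} ->
  U (Phi c0 t) ->
  {for (t, c0), continuous (fun z : R * R => (X z.2 z.1, Y z.2 z.1))}.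
Proof.
move=> cPhi cPsi Ut.
have cX : {for (t, c0), continuous (fun z : R * R => X z.2 z.1)}.
  exact: (continuous_comp cPhi (differentiable_continuous (dG _ Ut))).
suff cY : {for (t, c0), continuous (fun z : R * R => Y z.2 z.1)}.
  exact: (cvg_pair cX cY).
have nUt : \forall z \near (t, c0), U (Phi z.2 z.1) by apply: cPhi; exact: nearU.
have E : \forall z \near (t, c0), \sum_i Psi z.2 z.1 0 i *: 'D_(delta_mx 0 i) G (Phi z.2 z.1) =
    Y z.2 z.1 by apply: filterS nUt => z Uz; rewrite YE.
apply: (cvg_trans (near_eq_cvg E)); rewrite /= YE//.
apply: cvg_bigsum => i; apply: cvgZ.
  exact: (continuous_comp cPsi (@coord_continuous _ _ _ _ _ _)).
exact: (continuous_comp cPhi (differentiable_continuous (dDG _ _ Ut))).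
Qed.

Lemma pushed_variation t : derivable (Phi ^~ t) c0 1 -> U (Phi c0 t) ->
  is_derive c0 1 (X ^~ t) ('D_('D_1 (Phi ^~ t) c0) G (Phi c0 t)).
Proof.
move=> dPhi Ut.
exact: (is_derive_comp_curve G (Phi ^~ t) c0 _ (derivableP dPhi) (dG _ Ut)).
Qed.

Lemma pushed_growth t : derivable (Phi ^~ t) c0 1 -> derivable (Psi ^~ t) c0 1 ->
  U (Phi c0 t) -> exists K : R, 0 <= K /\
    \forall c \near c0, sqdist (X c t) (X c0 t) (Y c t) (Y c0 t) <= K * (c - c0) ^+ 2.
Proof.
move=> dPhi dPsi Ut.
have [dX _] := pushed_variation t dPhi Ut.
have cPhi : {for c0, continuous (Phi ^~ t)}.
  exact: (derivable_continuous (Phi ^~ t) c0 dPhi).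
have nUt : \forall c \near c0, U (Phi c t) by apply: cPhi; exact: nearU.
have dY : derivable (Y ^~ t) c0 1.
  have E : \forall c \near c0, \sum_i Psi c t 0 i *: ('D_(delta_mx 0 i) G \o (Phi ^~ t)) c =
      Y c t by apply: filterS nUt => c Uc; rewrite YE.
  apply: (near_eq_derivable E).
  have dE i : derivable ('D_(delta_mx 0 i) G \o (Phi ^~ t)) c0 1.
    by case: (is_derive_comp_curve _ (Phi ^~ t) c0 _ (derivableP dPhi)
      (dDG (delta_mx 0 i) _ Ut)).
  have dp i : derivable (fun c => Psi c t 0 i) c0 1 by exact: derivable_entry.
  by case: (derive_bigsum_curve (fun i c => Psi c t 0 i) _ c0 dp dE).
have [K1 [K10 H1]] := derivable_growth _ _ dX.
have [K2 [K20 H2]] := derivable_growth _ _ dY.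
exists (\sum_(i < n) (K1 ^+ 2 + K2 ^+ 2)); split.
  by apply: sumr_ge0 => i _; rewrite addr_ge0 ?sqr_ge0.
near=> c.
have h1 : `|X c t - X c0 t| <= K1 * `|c - c0| by near: c.
have h2 : `|Y c t - Y c0 t| <= K2 * `|c - c0| by near: c.
rewrite /sqdist mulr_suml; apply: ler_sum => i _; rewrite [X in _ <= X]mulrDl -!expr2 lerD//.
- have := le_trans (norm_entry_le (X c t - X c0 t) 0 i) h1.
  rewrite !mxE => hi; rewrite -exprMn -real_normK ?num_real// -[X in _ <= X]real_normK ?num_real//.
  by rewrite ler_sqr ?nnegrE// normrM (ger0_norm K10).
- have := le_trans (norm_entry_le (Y c t - Y c0 t) 0 i) h2.
  rewrite !mxE => hi; rewrite -exprMn -real_normK ?num_real// -[X in _ <= X]real_normK ?num_real//.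
  by rewrite ler_sqr ?nnegrE// normrM (ger0_norm K20).
Unshelve. all: by end_near. Qed.

(** The bound [K] does not depend on [t]. The geodesics [Phi c] and [Phi c0] have
    images that solve the same equation with Lipschitz constant [L] as long as they
    stay in [B], which holds from [t] to [t1] for [c] close to [c0], in a way that
    depends on [t]. Their distance at time [t1] is of order [c - c0]; by comparison
    so is their distance at [t], with a constant that is uniform in [t]. *)
Lemma variation_bounded (L t1 : R) (B : set (V * V)) (H : 'I_n -> 'I_n -> R) :
  (\forall c \near c0, forall s, 0 < s -> geodesic_equations g (Phi c) (Psi c) s) ->
  (forall t, 0 < t -> {for (t, c0), continuous (fun z : R * R => Phi z.2 z.1)}) ->
  (forall t, 0 < t -> {for (t, c0), continuous (fun z : R * R => Psi z.2 z.1)}) ->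
  (forall t, 0 < t -> derivable (Phi ^~ t) c0 1) ->
  (forall t, 0 < t -> derivable (Psi ^~ t) c0 1) ->
  0 < t1 -> 0 <= L -> open B ->
  (forall z z' i, B z -> B z' ->
    `|(- christoffel_form h z.1 z.2 z.2) 0 i
      - (- christoffel_form h z'.1 z'.2 z'.2) 0 i| <= L * `|z - z'|) ->
  (forall s, 0 < s <= t1 -> U (Phi c0 s) /\ B (X c0 s, Y c0 s)) ->
  (forall s i j, 0 < s <= t1 -> `|h (X c0 s) i j| <= H i j) ->
  exists K : R, forall t, 0 < t <= t1 ->
    `|inner g (Phi c0 t) ('D_1 (Phi ^~ t) c0) ('D_1 (Phi ^~ t) c0)| <= K.
Proof.
move=> geo cPhi cPsi dPhi dPsi t10 L0 oB lip UB hH.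
have [|U1 _] := UB t1; first by rewrite t10 lexx.
have [K1 [K10 growth]] := pushed_growth t1 (dPhi _ t10) (dPsi _ t10) U1.
pose C := 2 * n%:R * (1 + L).
have C0 : 0 <= C by rewrite !mulr_ge0// addr_ge0.
pose K0 := expR (C * t1) * K1.
exists (\sum_i \sum_j K0 * H i j) => t tt1.
have [t0 t1'] : 0 < t /\ t <= t1 by move: tt1 => /andP[].
have [Ut _] := UB t tt1.
(* The interval from t to t1 is compact, so the pointwise neighborhoods of c0 can be merged. *)
have stay : \forall c \near c0, forall s, t <= s <= t1 -> U (Phi c s) /\ B (X c s, Y c s).
  have cpt := (compact_near_coveringP _).1 (@segment_compact R t t1).
  pose P0 c s := U (Phi c s) /\ B (X c s, Y c s).
  suff : \forall c \near c0, `[t, t1]%classic `<=` P0 c.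
    by apply: filterS => c Hc s ts; apply: Hc; rewrite /= in_itv.
  refine (cpt R (nbhs c0) P0 (nbhs_filter c0) _) => s.
  rewrite /= in_itv/= => /andP[ts st1].
  have s0 : 0 < s := lt_le_trans t0 ts.
  have [Us Bs] : U (Phi c0 s) /\ B (X c0 s, Y c0 s) by apply: UB; rewrite s0.
  have nU : \forall z \near (s, c0), U (Phi z.2 z.1) by apply: (cPhi s s0); exact: nearU.
  have nB : \forall z \near (s, c0), B (X z.2 z.1, Y z.2 z.1).
    apply: (pushed_continuous s (cPhi s s0) (cPsi s s0) Us).
    exact: open_nbhs_nbhs.
  exact: (filterI nU nB).
have close : \forall c \near c0,
    sqdist (X c t) (X c0 t) (Y c t) (Y c0 t) <= K0 * (c - c0) ^+ 2.
  near=> c.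
  have gc : forall s, 0 < s -> geodesic_equations g (Phi c) (Psi c) s by near: c.
  have g0 : forall s, 0 < s -> geodesic_equations g (Phi c0) (Psi c0) s.
    exact: (nbhs_singleton geo).
  have sc : forall s, t <= s <= t1 -> U (Phi c s) /\ B (X c s, Y c s) by near: c.
  have gr : sqdist (X c t1) (X c0 t1) (Y c t1) (Y c0 t1) <= K1 * (c - c0) ^+ 2 by near: c.
  have nearpos (P : R -> Prop) (s : R) :
      0 < s -> (forall s, 0 < s -> P s) -> \forall s' \near s, P s'.
    by move=> s0 HP; near=> s'; apply: HP; near: s'; exact: lt_nbhsr.
  have cmp := @second_order_comparison R n
    (fun z => - christoffel_form h z.1 z.2 z.2) L B (X c) (Y c) (X c0) (Y c0) t t1 L0 lip t1'.
  apply: le_trans (cmp _ _) _.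
  - move=> s ts; have [Us Bs] := sc s ts.
    have s0 : 0 < s by move: ts => /andP[ts _]; exact: lt_le_trans ts.
    by have [] := pushed_equations c s (nearpos _ s s0 gc) Us.
  - move=> s ts.
    have s0 : 0 < s by move: ts => /andP[ts _]; exact: lt_le_trans ts.
    have [Us Bs] : U (Phi c0 s) /\ B (X c0 s, Y c0 s).
      by apply: UB; rewrite s0; move: ts => /andP[].
    by have [] := pushed_equations c0 s (nearpos _ s s0 g0) Us.
  rewrite -/C /K0 -mulrA ler_pM ?expR_ge0//.
    by apply: sumr_ge0 => i _; rewrite addr_ge0// -expr2 sqr_ge0.
  by rewrite ler_expR ler_wpM2l// gerBl ltW.
have [dX eX] := pushed_variation t (dPhi t t0) Ut.
set eta := 'D_1 (Phi ^~ t) c0 in eX *.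
have xi2 i : ('D_eta G (Phi c0 t)) 0 i ^+ 2 <= K0.
  rewrite -eX derive_coord//; apply: derive_sqr_le; first exact: derivable_entry.
  apply: filterS close => c; apply: le_trans.
  by have [] := sqdist_ge (X c t) (X c0 t) (Y c t) (Y c0 t) i.
rewrite (isometry_inner g h G U sG isom)// innerE.
apply: le_trans (ler_norm_sum _ _ _) _; apply: ler_sum => i _.
apply: le_trans (ler_norm_sum _ _ _) _; apply: ler_sum => j _.
rewrite normrM ler_pM//; last exact: hH.
set a := _ 0 i; set b := _ 0 j.
have a2 : a ^+ 2 <= K0 := xi2 i; have b2 : b ^+ 2 <= K0 := xi2 j.
have := sqr_ge0 (`|a| - `|b|); rewrite sqrrB !real_normK ?num_real// -normrM.
rewrite -mulr_natr; lra.
Unshelve. all: by end_near. Qed.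

End GeodesicVariation.

Section GeodesicSpray.
Context {R : realType} {n : nat}.
Local Notation V := 'rV[R]_n.

Lemma lipschitz_fst (p : V -> R) (z : V * V) :
  locally_lipschitz p z.1 -> locally_lipschitz (fun z => p z.1) z.
Proof.
move=> [L [e [L0 e0 H]]]; exists L, e; split=> // a b [za _] [zb _].
apply: le_trans (H _ _ za zb) _; rewrite ler_wpM2l// prod_normE /= le_max lexx.
by [].
Qed.

Lemma lipschitz_snd_entry (z : V * V) i : locally_lipschitz (fun z : V * V => z.2 0 i) z.
Proof.
exists 1, 1; split=> // a b _ _; rewrite mul1r prod_normE /= le_max.
apply/orP; right; have := norm_entry_le (a.2 - b.2) 0 i.
by rewrite !mxE.
Qed.

Lemma spray_lipschitz (W : set V) (h : V -> 'M[R]_n) (z : V * V) :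
  open W -> W z.1 -> smooth_on W h -> (forall y, W y -> h y \in unitmx) ->
  exists L e : R, [/\ 0 <= L, 0 < e & forall a b i, ball z e a -> ball z e b ->
    `|(- christoffel_form h a.1 a.2 a.2) 0 i
      - (- christoffel_form h b.1 b.2 b.2) 0 i| <= L * `|a - b|].
Proof.
move=> oW Wz sh hu.
have lip i : locally_lipschitz (fun a : V * V => (- christoffel_form h a.1 a.2 a.2) 0 i) z.
  apply: (lipschitz_eq_near (fun a : V * V =>
    (-1) * \sum_j \sum_l christoffel h a.1 i j l * a.2 0 j * a.2 0 l)).
    by near=> a; rewrite mulN1r !mxE.
  apply: lipschitz_mul; first exact: lipschitz_const.
  apply: lipschitz_sum => j; apply: lipschitz_sum => l.
  apply: lipschitz_mul; last exact: lipschitz_snd_entry.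
  apply: lipschitz_mul; last exact: lipschitz_snd_entry.
  exact/(lipschitz_fst (fun x => christoffel h x i j l))/(christoffel_lipschitz W).
have [L /choice[e He]] := choice lip.
have near_e : \forall a \near z, forall i, ball z (e i) a.
  apply: (@filter_forall _ _ (fun i => ball z (e i)) (nbhs z) _) => i.
  by have [_ ei _] := He i; exact: nbhsx_ballx.
have [/= r r0 ze] := (nbhs_ballP _ _).1 near_e.
have L0 i : 0 <= L i by have [] := He i.
exists (\sum_i L i), r; split=> //; first exact: sumr_ge0.
move=> a b i za zb.
have [_ _ H] := He i.
apply: le_trans (H a b (ze a za i) (ze b zb i)) _.
by rewrite ler_wpM2r// (bigD1 i)//= lerDl sumr_ge0.
Unshelve. all: by end_near. Qed.

End GeodesicSpray.

Section EmbeddedVariation.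
Context {R : realType} {n p q p' q' : nat}.
Local Notation V := 'rV[R]_n.
Variables (g : V -> 'M[R]_n) (N : manifold_data R n) (F : coordinate_space g -> N).
Hypotheses (Mg : pseudo_riemannian p q (coordinate_space g)).
Hypotheses (NN : pseudo_riemannian p' q' N) (complete : geodesically_complete N).
Hypotheses (sF : smooth_map F) (mF : preserves_metric F).
Variables (Phi Psi : R -> R -> V) (c0 : R).
Hypothesis geo : \forall c \near c0, forall s, 0 < s -> geodesic_equations g (Phi c) (Psi c) s.
Hypothesis cPhi : forall t, 0 < t -> {for (t, c0), continuous (fun z : R * R => Phi z.2 z.1)}.
Hypothesis cPsi : forall t, 0 < t -> {for (t, c0), continuous (fun z : R * R => Psi z.2 z.1)}.
Hypothesis dPhi : forall t, 0 < t -> derivable (Phi ^~ t) c0 1.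
Hypothesis dPsi : forall t, 0 < t -> derivable (Psi ^~ t) c0 1.

Let cF : continuous (F : V -> N). Proof. by case: sF. Qed.

Let U (d : chart N) : set V := (F : V -> N) @^-1` dom d.
Let G (d : chart N) : V -> V := Defs.coord d \o F.

Let domd (d : chart N) : open (dom d).
Proof. by case: NN => _ _ /(_ d)[]. Qed.

Let oU d : open (U d). Proof. by apply: open_comp => // x _; exact: cF. Qed.

Let oW (d : chart N) : open (chart_image d).
Proof. by case: NN => _ _ /(_ d)[]. Qed.

Let UW d x : U d x -> chart_image d (G d x). Proof. by move=> Ux; exists (F x). Qed.

Let sG d : smooth_on (U d) (G d).
Proof.
move=> vs x Ux; have [_ /(_ tt d)] := sF; move=> /(_ vs x); apply.
by exists x.
Qed.

Let sg d : smooth_on (U d) g.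
Proof.
move=> vs x Ux; case: Mg => _ _ _ _ /(_ tt)[sg _]; apply: sg.
by exists x.
Qed.

Let sh (d : chart N) : smooth_on (chart_image d) (metric d).
Proof. by case: NN => _ _ _ _ /(_ d)[]. Qed.

Let sign x : has_signature p q (g x).
Proof. by case: Mg => _ _ _ _ /(_ tt)[_]; apply; exists x. Qed.

Let signN (d : chart N) x : chart_image d x -> has_signature p' q' (metric d x).
Proof. by case: NN => _ _ _ _ /(_ d)[_]; apply. Qed.

Let gs d x : U d x -> (g x)^T = g x. Proof. by move=> _; exact: signature_sym (sign x). Qed.
Let gu d x : U d x -> g x \in unitmx. Proof. by move=> _; exact: signature_unit (sign x). Qed.
Let hs (d : chart N) x : chart_image d x -> (metric d x)^T = metric d x.
Proof. by move=> /signN; exact: signature_sym. Qed.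
Let hu (d : chart N) x : chart_image d x -> metric d x \in unitmx.
Proof. by move=> /signN; exact: signature_unit. Qed.
Let isom d x : U d x -> g x = 'J (G d) x *m metric d (G d x) *m ('J (G d) x)^T.
Proof. by move=> Ux; exact: (mF tt d x I Ux). Qed.

Let geo0 (s : R) : 0 < s -> \forall s' \near s, geodesic_equations g (Phi c0) (Psi c0) s'.
Proof.
move=> s0; near=> s'; apply: (nbhs_singleton geo); near: s'; exact: lt_nbhsr.
Unshelve. all: by end_near. Qed.

Let image_geodesic : geodesic_on `]0, +oo[%classic ((F : V -> N) \o Phi c0).
Proof.
move=> t; rewrite /= in_itv/= andbT => t0.
have [geo_t _] := geodesic_equations_geodesic g _ _ t (geo0 t t0).
have ct : {for t, continuous (Phi c0)}.
  by apply: derivable_continuous; have [[]] := nbhs_singleton (geo0 t t0).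
split; first exact: (continuous_comp ct (cF _)).
move=> d Ud.
have [A _] := isometry_geodesic g (metric d) (G d) (U d) (chart_image d) (oU d)
  (UW d) (sG d) (sg d) (sh d) (gs d) (gu d) (hs d) (hu d) (isom d) (Phi c0) t Ud geo_t.
exact: A.
Qed.

(** A complete target prolongs the image of [Phi c0] to the time [0]. In a chart
    [d] around its position [gamma 0], the position and the velocity are continuous
    at [0], so for small [t] they stay in a ball on which the geodesic equation is
    Lipschitz and the metric is bounded. *)
Lemma embedded_variation_bounded : exists K r : R, 0 < r /\
  forall t, 0 < t <= r ->
    `|inner g (Phi c0 t) ('D_1 (Phi ^~ t) c0) ('D_1 (Phi ^~ t) c0)| <= K.
Proof.
have [] := complete `]0, +oo[%classic ((F : V -> N) \o Phi c0) _ _ image_geodesic.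
- exact: interval_open.
- exact: interval_is_interval.
move=> gamma geo_gamma gammaE.
have gammaE' (t : R) : 0 < t -> gamma t = F (Phi c0 t).
  by move=> t0; apply: gammaE; rewrite /= in_itv/= t0.
have [d d0] : exists d, dom d (gamma 0) by case: NN => _ + _ _ _; apply.
have [c_gamma /(_ d d0)/=[dsigma ddsigma _]] := geo_gamma 0 I.
set sigma := Defs.coord d \o gamma in dsigma ddsigma.
have csigma : {for 0, continuous sigma}.
  by apply: derivable_continuous; exact: nbhs_singleton dsigma.
have cdsigma : {for 0, continuous (derive1 sigma)} by exact: derivable_continuous.
have W0 : chart_image d (sigma 0) by exists (gamma 0).
have [L [e [L0 e0 lip]]] := spray_lipschitz (chart_image d) (metric d)
  (sigma 0, derive1 sigma 0) (oW d) W0 (sh d) (hu d).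
have [B [oB B0 lipB]] : exists B : set (V * V),
    [/\ open B, B (sigma 0, derive1 sigma 0) & forall a b i, B a -> B b ->
    `|(- christoffel_form (metric d) a.1 a.2 a.2) 0 i
      - (- christoffel_form (metric d) b.1 b.2 b.2) 0 i| <= L * `|a - b|].
  exists (ball (sigma 0, derive1 sigma 0) e); split; first exact: ball_open.
    exact: ballxx.
  exact: lip.
have hbound i j : exists H : R, \forall y \near sigma 0, `|metric d y i j| <= H.
  have [H [r [_ r0 Hr]]] := lipschitz_bounded _ _
    (smooth_on_entry_lipschitz (chart_image d) (metric d) (sigma 0) i j (oW d) W0 (sh d)).
  by exists H; apply/nbhs_ballP; exists r.
have [H HH] := choice (fun ij => hbound ij.1 ij.2).
have [C [nC CH]] : exists C : set V, nbhs (sigma 0) C /\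
    forall y, C y -> forall i j, `|metric d y i j| <= H (i, j).
  exists [set y | forall ij : 'I_n * 'I_n, `|metric d y ij.1 ij.2| <= H ij].
  split; last by move=> y Cy i j; exact: (Cy (i, j)).
  apply: (@filter_forall _ _ (fun ij y => `|metric d y ij.1 ij.2| <= H ij)
    (nbhs (sigma 0)) _) => ij; exact: HH.
have near0 : \forall s \near 0, [/\ dom d (gamma s), B (sigma s, derive1 sigma s) &
    C (sigma s)].
  have n1 : \forall s \near 0, dom d (gamma s).
    by apply: c_gamma; apply: open_nbhs_nbhs; split=> //; exact: domd.
  have nB : nbhs (sigma 0, derive1 sigma 0) B by exact: open_nbhs_nbhs.
  have cp : {for 0, continuous (fun s => (sigma s, derive1 sigma s))}.
    exact: (cvg_pair csigma cdsigma).
  have n2 : \forall s \near 0, B (sigma s, derive1 sigma s) by exact: (cp _ nB).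
  have n3 : \forall s \near 0, C (sigma s) by exact: (csigma _ nC).
  by near=> s; split; near: s.
have [/= r r0 Hr] := (nbhs_ballP _ _).1 near0.
have Hr' (s : R) : 0 < s <= r / 2 -> [/\ dom d (gamma s), B (sigma s, derive1 sigma s) &
    C (sigma s)].
  move=> /andP[s0 sr]; apply: Hr; rewrite -ball_normE /ball_/= sub0r normrN gtr0_norm//.
  by apply: le_lt_trans sr _; rewrite ltr_pdivrMr// ltr_pMr// ltr1n.
have r20 : 0 < r / 2 by rewrite divr_gt0.
have UB (s : R) : 0 < s <= r / 2 -> U d (Phi c0 s) /\
    B (G d (Phi c0 s), 'D_(Psi c0 s) (G d) (Phi c0 s)).
  move=> sr; have s0 : 0 < s by case/andP: sr.
  have [ds Bs _] := Hr' s sr.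
  have Us : U d (Phi c0 s) by rewrite /U/= -gammaE'.
  split; first exact: Us.
  have sE : \forall s' \near s, G d (Phi c0 s') = sigma s'.
    near=> s'; rewrite /sigma /G /= gammaE'//; near: s'; exact: lt_nbhsr.
  have [geo_s e1] := geodesic_equations_geodesic g _ _ s (geo0 s s0).
  have [_ e2] := isometry_geodesic g (metric d) (G d) (U d) (chart_image d) (oU d)
    (UW d) (sG d) (sg d) (sh d) (gs d) (gu d) (hs d) (hu d) (isom d) (Phi c0) s Us geo_s.
  have e3 : derive1 sigma s = 'D_(Psi c0 s) (G d) (Phi c0 s).
    rewrite -e1; refine (etrans _ e2).
    refine (etrans (derive1E _ _) (etrans _ (esym (derive1E _ _)))).
    by apply: near_eq_derive; apply: filterS sE => s' /esym.
  by rewrite -e3 (nbhs_singleton sE).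
have hH (s : R) i j : 0 < s <= r / 2 -> `|metric d (G d (Phi c0 s)) i j| <= H (i, j).
  move=> sr; have s0 : 0 < s by case/andP: sr.
  have [_ _ /CH/(_ i j)] := Hr' s sr.
  by rewrite /sigma /G /= gammaE'.
have [K HK] := variation_bounded g (metric d) (G d) (U d) (chart_image d) (oU d)
  (UW d) (sG d) (sg d) (sh d) (gs d) (gu d) (hs d) (hu d) (isom d) Phi Psi c0 L (r / 2) B
  (fun i j => H (i, j)) geo cPhi cPsi dPhi dPsi r20 L0 oB lipB UB hH.
by exists K, (r / 2).
Unshelve. all: by end_near. Qed.

End EmbeddedVariation.

#[local] Transparent derive derive1.

(** * Operators with one Jordan block of height two *)

Section Similarity.
Context {F : fieldType} {n : nat}.
Implicit Types (A T P : 'M[F]_n).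

Lemma char_poly_conj A T P : P \in unitmx -> P *m A = T *m P ->
  char_poly A = char_poly T.
Proof.
move=> Pu PA; rewrite /char_poly.
have dP : \det (map_mx polyC P) != 0.
  by rewrite det_map_mx polyC_eq0 -unitfE -unitmxE.
apply: (mulfI dP); rewrite -det_mulmx [RHS]mulrC -det_mulmx; congr (\det _).
by rewrite /char_poly_mx mulmxBr mulmxBl -!map_mxM PA scalar_mxC.
Qed.

Lemma diagonalizable_conj A P (d : 'rV_n) : P \in unitmx ->
  P *m A = diag_mx d *m P -> diagonalizable A.
Proof.
move=> Pu PA; exists P => //.
have : similar P A (diag_mx d) by apply/similarP.
by rewrite /similar_to/= => /eqP ->; exact: diag_mx_is_diag.
Qed.

(** A diagonalizable operator has no Jordan block, so a generalized
    eigenvector of height two is an eigenvector. *)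
Lemma diagonalizable_height1 A (c : F) (e : 'rV_n) : diagonalizable A ->
  (e *m A - c *: e) *m A = c *: (e *m A - c *: e) -> e *m A = c *: e.
Proof.
move=> [P Pu /similar_diagPex[d /(similarP Pu) PA]] e2.
have [u eu] : exists u, e = u *m P by exists (e *m invmx P); rewrite mulmxKV.
have uA : e *m A - c *: e = (u *m diag_mx d - c *: u) *m P.
  by rewrite [in LHS]eu mulmxBl -!mulmxA PA !scalemxAl.
apply/eqP; rewrite -subr_eq0 uA; apply/eqP.
suff -> : u *m diag_mx d - c *: u = 0 by rewrite mul0mx.
move: e2; rewrite uA -mulmxA PA !scalemxAl mulmxA => /(can_inj (mulmxK Pu)).
move=> /rowP e2; apply/rowP => i; have := e2 i.
rewrite !mul_mx_diag !mxE => /eqP; rewrite -subr_eq0.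
have -> : (u 0 i * d 0 i - c * u 0 i) * d 0 i - c * (u 0 i * d 0 i - c * u 0 i)
   = u 0 i * (d 0 i - c) ^+ 2 by ring.
rewrite mulf_eq0 expf_eq0/= => /orP[/eqP -> |/eqP di].
  by rewrite mul0r mulr0 subr0.
by rewrite mulrC -mulrBl di mul0r.
Qed.

End Similarity.

Section OssermanAlgebra.
Context {R : realType}.
Variables (g : 'rV[R]_4 -> 'M[R]_4) (x : 'rV[R]_4).
Local Notation "<( u , v )>" := (inner g x u v).
Hypothesis gs : (g x)^T = g x.

Lemma innerDl u1 u2 v : <(u1 + u2, v)> = <(u1, v)> + <(u2, v)>.
Proof. by rewrite /inner !mulmxDl mxE. Qed.

Lemma innerZl a u v : <(a *: u, v)> = a * <(u, v)>.
Proof. by rewrite /inner -!scalemxAl mxE. Qed.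

Lemma inner0l v : <(0, v)> = 0.
Proof. by rewrite /inner !mul0mx mxE. Qed.

Variables (k rho eps : R) (v w m : 'rV[R]_4) (A : 'M[R]_4).
Hypothesis eps2 : eps ^+ 2 = 1.
Hypothesis vv : <(v, v)> = eps.
Hypothesis ww : <(w, w)> = - eps.
Hypothesis vw : <(v, w)> = 0.
Hypothesis mv : <(m, v)> = 0.
Hypothesis mw : <(m, w)> = 0.
Hypothesis mm : <(m, m)> = 0.
Variable (e0 : 'rV[R]_4).
Hypothesis e0m : <(e0, m)> != 0.
Hypothesis AE : forall y, y *m A =
  k *: (eps *: y - <(y, v)> *: v) - (3 * k * <(y, w)>) *: w + (rho * <(y, m)>) *: m.

Let e := e0 - (eps * <(e0, v)>) *: v + (eps * <(e0, w)>) *: w.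
Let s := <(e0, m)>.

Let wv : <(w, v)> = 0. Proof. by rewrite innerC. Qed.
Let vm : <(v, m)> = 0. Proof. by rewrite innerC. Qed.
Let wm : <(w, m)> = 0. Proof. by rewrite innerC. Qed.

Let ev : <(e, v)> = 0.
Proof.
rewrite /e -scaleNr !innerDl !innerZl vv wv mulr0 addr0.
by rewrite mulNr mulrAC -expr2 eps2 mul1r subrr.
Qed.

Let ew : <(e, w)> = 0.
Proof.
rewrite /e -scaleNr !innerDl !innerZl ww vw mulr0 addr0.
by rewrite mulrN mulrAC -expr2 eps2 mul1r subrr.
Qed.

Let em : <(e, m)> = s.
Proof. by rewrite /e -scaleNr !innerDl !innerZl vm wm !mulr0 !addr0. Qed.

Let vA : v *m A = 0.
Proof. by rewrite AE vv vw vm !mulr0 !scale0r subrr scaler0 addr0 subr0. Qed.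

Let wA : w *m A = (4 * (eps * k)) *: w.
Proof.
rewrite AE wv ww wm mulr0 !scale0r subr0 addr0 scalerA -scalerBl.
by congr (_ *: _); ring.
Qed.

Let mA : m *m A = (eps * k) *: m.
Proof.
by rewrite AE mv mw mm !mulr0 !scale0r !subr0 addr0 scalerA mulrC.
Qed.

Let eA : e *m A = (eps * k) *: e + (rho * s) *: m.
Proof.
by rewrite AE ev ew em mulr0 !scale0r !subr0 scalerA [k * _]mulrC.
Qed.

Let P : 'M[R]_4 := \matrix_(i < 4) nth 0 [:: v; w; m; e] i.

Let rowP4 (u : 'rV[R]_4) : u *m P =
  u 0 0 *: v + u 0 1 *: w + u 0 (inord 2) *: m + u 0 (inord 3) *: e.
Proof.
rewrite mulmx_sum_row !big_ord_recl big_ord0 addr0 !rowK/= !addrA.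
do 3?[congr (_ + _)]; congr (u 0 _ *: _); apply/val_inj; by rewrite /= ?inordK.
Qed.

Let Punit : P \in unitmx.
Proof.
rewrite -row_free_unit; apply: inj_row_free => u; rewrite rowP4 => u0.
have pair r : u 0 0 * <(v, r)> + u 0 1 * <(w, r)> + u 0 (inord 2) * <(m, r)>
    + u 0 (inord 3) * <(e, r)> = 0.
  by rewrite -!innerZl -!innerDl u0 inner0l.
have eps0 : eps != 0.
  by apply/eqP => e0'; move: eps2 => /eqP; rewrite e0' expr0n eq_sym oner_eq0.
have uv : u 0 0 = 0.
  have := pair v; rewrite vv wv mv ev !mulr0 !addr0 => /eqP.
  by rewrite mulf_eq0 (negbTE eps0) orbF => /eqP.
have uw : u 0 1 = 0.
  have := pair w; rewrite vw ww mw ew !mulr0 !addr0 add0r => /eqP.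
  by rewrite mulf_eq0 oppr_eq0 (negbTE eps0) orbF => /eqP.
have ue : u 0 (inord 3) = 0.
  have := pair m; rewrite vm wm mm em !mulr0 !add0r => /eqP.
  by rewrite mulf_eq0 (negbTE e0m) orbF => /eqP.
have um : u 0 (inord 2) = 0.
  have := pair e; rewrite uv uw ue !mul0r !add0r addr0 (innerC _ _ m) // em => /eqP.
  by rewrite mulf_eq0 (negbTE e0m) orbF => /eqP.
apply/rowP => -[[|[|[|[|//]]]] i]; rewrite mxE.
- by rewrite -[RHS]uv; congr (u 0 _); apply/val_inj.
- by rewrite -[RHS]uw; congr (u 0 _); apply/val_inj.
- by rewrite -[RHS]um; congr (u 0 _); apply/val_inj; rewrite /= inordK.
- by rewrite -[RHS]ue; congr (u 0 _); apply/val_inj; rewrite /= inordK.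
Qed.

Let d : 'rV[R]_4 := \row_i nth 0 [:: 0; 4 * (eps * k); eps * k; eps * k] i.

Let PA : P *m A = (diag_mx d + (rho * s) *: delta_mx (inord 3) (inord 2)) *m P.
Proof.
apply/row_matrixP => i; rewrite row_mul rowK row_mul rowP4.
rewrite !mxE.
case: i => -[|[|[|[|//]]]] i /=; rewrite ?vA ?wA ?mA ?eA -!val_eqE/= ?inordK//=.
all: by rewrite ?(mulr0n,mulr1n,mulr0,mulr1,scale0r,addr0,add0r)// addrC.
Qed.

(** In the basis [v], [w], [m], [e] the operator is triangular. The vector [e] is the
    component of [e0] orthogonal to [v] and [w]; pairing with [m] keeps it
    independent of the others. *)
Lemma osserman_char_poly :
  char_poly A = 'X * ('X - (4 * (eps * k))%:P) * ('X - (eps * k)%:P) ^+ 2.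
Proof.
rewrite (char_poly_conj _ _ _ Punit PA) char_poly_trig.
  rewrite !big_ord_recl big_ord0 !mxE -!val_eqE/= ?inordK//= /bump/=.
  by rewrite !(mulr0,mulr0n,mulr1n,addr0) polyC0 subr0; ring.
apply/is_trig_mxP => i j ij; rewrite !mxE.
rewrite (_ : (i == j) = false) ?mulr0n ?add0r; last by apply/negbTE; rewrite -val_eqE ltn_eqF.
have [i3|_] := eqVneq i; last by rewrite mulr0.
have [j2|_] := eqVneq j; last by rewrite mulr0.
by move: ij; rewrite i3 j2 !inordK.
Qed.

(** Since [(A - eps k) e = rho s m] and [(A - eps k) m = 0] with [s <> 0], the vector
    [e] has height two unless [rho] vanishes. *)
Lemma osserman_diagonalizable : diagonalizable A <-> rho = 0.
Proof.
split=> [dA|rho0].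
  have := diagonalizable_height1 A (eps * k) e dA.
  rewrite eA [_ + _ - _]addrAC subrr add0r -scalemxAl mA !scalerA.
  rewrite [_ * (eps * k)]mulrC => /(_ erefl).
  move=> /eqP; rewrite -subr_eq0 [_ + _ - _]addrAC subrr add0r.
  rewrite scaler_eq0 mulf_eq0 (negbTE e0m) orbF => /orP[/eqP //|/eqP m0].
  by move: e0m; rewrite innerC// m0 inner0l eqxx.
by apply: (diagonalizable_conj _ P d Punit); rewrite PA rho0 mul0r scale0r addr0.
Qed.

End OssermanAlgebra.

(** * The connection and the curvature of the metric *)

Notation "u `_1" := (u 0 (inord 0)) (at level 2, format "u `_1").
Notation "u `_2" := (u 0 (inord 1)) (at level 2, format "u `_2").
Notation "u `_3" := (u 0 (inord 2)) (at level 2, format "u `_3").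
Notation "u `_4" := (u 0 (inord 3)) (at level 2, format "u `_4").

Definition row4 {R : realType} (a b c d : R) : 'rV[R]_4 :=
  \row_(i < 4) nth 0 [:: a; b; c; d] i.

Lemma row4E {R : realType} (a b c d : R) :
  ((row4 a b c d)`_1 = a) * ((row4 a b c d)`_2 = b) *
  ((row4 a b c d)`_3 = c) * ((row4 a b c d)`_4 = d).
Proof. by rewrite /row4 !mxE !inordK. Qed.

Lemma sum4 {R : realType} (F : 'I_4 -> R) :
  \sum_i F i = F (inord 0) + F (inord 1) + F (inord 2) + F (inord 3).
Proof.
rewrite !big_ord_recl big_ord0 addr0 !addrA.
by congr (F _ + F _ + F _ + F _); apply/val_inj; rewrite /= inordK.
Qed.

Lemma eq_row4 {R : realType} (u v : 'rV[R]_4) :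
  u`_1 = v`_1 -> u`_2 = v`_2 -> u`_3 = v`_3 -> u`_4 = v`_4 -> u = v.
Proof.
move=> e0 e1 e2 e3; apply/rowP => i.
have -> : i = inord i by rewrite inord_val.
by case: i => -[|[|[|[|]]]].
Qed.

Section Walker.
Context {R : realType}.
Variables (k : R) (f : R -> R).
Hypothesis k0 : k != 0.
Hypothesis fsmooth : forall (n : nat) (t : R), derivable (derive1n n f) t 1.
Local Notation g := (walker_metric k f).
Local Notation V := 'rV[R]_4.
Implicit Types (x u v w y : V).

Lemma inner_walker x u v : inner g x u v =
  u`_1 * v`_3 + u`_3 * v`_1 + u`_2 * v`_4 + u`_4 * v`_2
  + psi33 k f x * (u`_3 * v`_3) + psi34 k f x * (u`_3 * v`_4 + u`_4 * v`_3)
  + psi44 k x * (u`_4 * v`_4).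
Proof. by rewrite innerE !sum4 !mxE !inordK//=; ring. Qed.

(** [h3 0] and [h4 0] span a null complement of the null plane of the first two
    coordinates, in duality with it. Moving [h3 0] by half of its dual vector in
    either direction yields a timelike and a spacelike vector. *)
Lemma walker_signature x : has_signature 2 2 (g x).
Proof.
split => //.
pose h3 a := row4 (a - psi33 k f x / 2) (- (psi34 k f x / 2)) 1 0.
pose h4 a := row4 (- (psi34 k f x / 2)) (a - psi44 k x / 2) 0 1.
pose frame (i : nat) : V := nth 0 [:: h3 (- 2^-1); h4 (- 2^-1); h3 2^-1; h4 2^-1] i.
have gramE (i j : 'I_4) : inner g x (frame i) (frame j) =
    (if (i < 2)%N then -1 else 1) *+ (i == j).
  case: i => -[|[|[|[|//]]]] ?; case: j => -[|[|[|[|//]]]] ?;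
  rewrite -val_eqE /frame /= inner_walker /h3 /h4 !row4E ?mulr1n ?mulr0n; by field.
pose P : 'M[R]_4 := \matrix_(i < 4) frame i.
have PgP : P *m g x *m P^T = diag_mx (\row_(i < 4) (if (i < 2)%N then -1 else 1)).
  apply/matrixP => i j; rewrite !mxE -gramE /inner [RHS]mxE.
  apply: eq_bigr => l _; rewrite [in LHS]mxE [in RHS]mxE !mxE; congr (_ * _).
  by apply: eq_bigr => l1 _; rewrite [P _ _]mxE.
exists P => //.
have : P *m g x *m P^T \in unitmx.
  rewrite PgP unitmxE det_diag !big_ord_recl big_ord0 !mxE/= !mulr1 mulN1r opprK.
  exact: unitr1.
by rewrite !unitmx_mul => /andP[/andP[]].
Qed.

Lemma walker_unit x : g x \in unitmx.
Proof. exact: signature_unit (walker_signature x). Qed.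

Lemma walker_sym x : (g x)^T = g x.
Proof. exact: signature_sym (walker_signature x). Qed.

Local Notation F n := (fun x : V => derive1n n f x`_4).

Lemma is_derive_coord x v (i : 'I_4) : is_derive x v (fun z : V => z 0 i) (v 0 i).
Proof.
have dc : differentiable (fun z : V => z 0 i) x by exact: differentiable_coord.
apply: DeriveDef; first exact: diff_derivable.
by rewrite -derive_coord ?derive_id//; exact: derivable_id.
Qed.

Lemma differentiable_F n x : differentiable (F n) x.
Proof.
apply: (@differentiable_comp _ _ _ _ (fun z : V => z`_4) (derive1n n f)).
  exact: differentiable_coord.
exact/derivable1_diffP.
Qed.

Lemma is_derive_F n x v : is_derive x v (F n) (derive1n n.+1 f x`_4 * v`_4).
Proof.
have dF := differentiable_F n x.
apply: DeriveDef; first exact: diff_derivable.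
rewrite deriveE// (@diff_comp _ _ _ _ (fun z : V => z`_4) (derive1n n f))//=; last 2 first.
- exact: differentiable_coord.
- exact/derivable1_diffP.
rewrite diff1E; last exact/derivable1_diffP.
rewrite -deriveE; last exact: differentiable_coord.
have [_ ->] := is_derive_coord x v (inord 3).
by rewrite /= mulrC.
Qed.

End Walker.

(* Comparing two indices must not compute their values. *)
#[local] Opaque inord.

Section WalkerCurvature.
Context {R : realType}.
Variables (k : R) (f : R -> R).
Hypothesis k0 : k != 0.
Hypothesis fsmooth : forall (n : nat) (t : R), derivable (derive1n n f) t 1.
Local Notation g := (walker_metric k f).
Local Notation V := 'rV[R]_4.
Implicit Types (x u v w y : V).
Local Notation F n x := (derive1n n f x`_4).

(* The leading idtac delays the match until the tactic runs on a leaf. *)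
Ltac diff_coords := derive_by ltac:(idtac; lazymatch goal with
  | |- is_derive _ _ (fun z => derive1n ?n f (@?q z)) _ => exact: (is_derive_F f fsmooth n)
  | |- _ => exact: is_derive_coord
  end).

(* Normalization compares atoms up to conversion, which is slow on matrix entries;
   variables are compared at once. *)
Ltac abstract_entries u :=
  generalize (u 0 (inord 0)) (u 0 (inord 1)) (u 0 (inord 2)) (u 0 (inord 3)).
Ltac abstract_jets x :=
  let t := constr:(x 0 (inord 3)) in
  generalize (f t) (derive1 f t) (derive1 (derive1 f) t)
    (derive1 (derive1 (derive1 f)) t).

Definition dpsi33 x v : R := 8 * k * x`_1 * v`_1 - (2 * k)^-1 * F 0 x * F 1 x * v`_4.
Definition dpsi44 x v : R := 8 * k * x`_2 * v`_2.
Definition dpsi34 x v : R := 4 * k * (x`_1 * v`_2 + x`_2 * v`_1)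
  + F 0 x * v`_2 + x`_2 * F 1 x * v`_4 - (4 * k)^-1 * F 2 x * v`_4.

Lemma is_derive_psi33 x v : is_derive x v (psi33 k f) (dpsi33 x v).
Proof.
rewrite (_ : psi33 k f = fun z => 4 * k * (z`_1 * z`_1) - (4 * k)^-1 * (F 0 z * F 0 z)).
  diff_coords.
  by rewrite /dpsi33 /=; field.
by apply/funext => z; rewrite /psi33 !expr2.
Qed.

Lemma is_derive_psi44 x v : is_derive x v (psi44 k) (dpsi44 x v).
Proof.
rewrite (_ : psi44 k = fun z => 4 * k * (z`_2 * z`_2)).
  diff_coords.
  by rewrite /dpsi44 /=; ring.
by apply/funext => z; rewrite /psi44 !expr2.
Qed.

Lemma is_derive_psi34 x v : is_derive x v (psi34 k f) (dpsi34 x v).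
Proof.
rewrite (_ : psi34 k f = fun z =>
  4 * k * z`_1 * z`_2 + z`_2 * F 0 z - (4 * k)^-1 * F 1 z) //.
diff_coords.
by rewrite /dpsi34 /=; field.
Qed.

Lemma differentiable_walker x : differentiable g x.
Proof.
have dc i : differentiable (fun z : V => z 0 i) x by exact: differentiable_coord.
have dF n := differentiable_F f fsmooth n x.
have d33 : differentiable (psi33 k f) x.
  rewrite (_ : psi33 k f = fun z => 4 * k * (z`_1 * z`_1) - (4 * k)^-1 * (F 0 z * F 0 z)).
    by differentiable_pointwise ltac:(first [exact: dc | exact: (dF 0)]).
  by apply/funext => z; rewrite /psi33 !expr2.
have d44 : differentiable (psi44 k) x.
  rewrite (_ : psi44 k = fun z => 4 * k * (z`_2 * z`_2)).
    by differentiable_pointwise ltac:(exact: dc).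
  by apply/funext => z; rewrite /psi44 !expr2.
have d34 : differentiable (psi34 k f) x.
  rewrite (_ : psi34 k f = fun z =>
    4 * k * z`_1 * z`_2 + z`_2 * F 0 z - (4 * k)^-1 * F 1 z) //.
  by differentiable_pointwise ltac:(first [exact: dc | exact: (dF 0) | exact: (dF 1)]).
apply/differentiable_mxP => i j.
case: i => -[|[|[|[|//]]]] ?; case: j => -[|[|[|[|//]]]] ?;
under eq_fun do rewrite mxE /=; exact: differentiable_cst || assumption.
Qed.

Lemma derive_inner_walker x u v w : 'D_w (fun y => inner g y u v) x =
  dpsi33 x w * (u`_3 * v`_3) + dpsi34 x w * (u`_3 * v`_4 + u`_4 * v`_3)
  + dpsi44 x w * (u`_4 * v`_4).
Proof.
under eq_fun do rewrite inner_walker.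
apply: derive_of; derive_by ltac:(first
  [ exact: is_derive_psi33 | exact: is_derive_psi34 | exact: is_derive_psi44 ]).
by ring.
Qed.

Definition sym2 u v (i j : nat) : R :=
  u 0 (inord i) * v 0 (inord j) + u 0 (inord j) * v 0 (inord i).

(** The four entries come from raising the index in the Koszul formula;
    [walker_christoffelE] checks them by lowering the index again. *)
Definition christoffel_entry1 x u v : R :=
    4 * k * x`_1 * sym2 u v 0%N 2%N + 2 * k * x`_2 * sym2 u v 0%N 3%N
    + (F 0 x / 2 + 2 * k * x`_1) * sym2 u v 1%N 3%N
    + (16 * k ^+ 2 * (x`_1 * x`_1 * x`_1) - x`_1 * (F 0 x * F 0 x)) * (u`_3 * v`_3)
    + (16 * k ^+ 2 * (x`_1 * x`_1 * x`_2) + 4 * k * (x`_1 * x`_2 * F 0 x)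
       - x`_1 * F 1 x / 2 - 3 / (8 * k) * (F 0 x * F 1 x)) * sym2 u v 2%N 3%N
    + (16 * k ^+ 2 * (x`_1 * x`_2 * x`_2) + 4 * k * (x`_2 * x`_2 * F 0 x)
       - F 2 x / (4 * k)) * (u`_4 * v`_4).

Definition christoffel_entry2 x u v : R :=
    2 * k * x`_2 * sym2 u v 0%N 2%N + (F 0 x / 2 + 2 * k * x`_1) * sym2 u v 1%N 2%N
    + 4 * k * x`_2 * sym2 u v 1%N 3%N
    + (16 * k ^+ 2 * (x`_1 * x`_1 * x`_2) + 4 * k * (x`_1 * x`_2 * F 0 x)
       - x`_1 * F 1 x + F 0 x * F 1 x / (4 * k)) * (u`_3 * v`_3)
    + (16 * k ^+ 2 * (x`_1 * x`_2 * x`_2) + 4 * k * (x`_2 * x`_2 * F 0 x)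
       - x`_2 * F 1 x / 2) * sym2 u v 2%N 3%N
    + 16 * k ^+ 2 * (x`_2 * x`_2 * x`_2) * (u`_4 * v`_4).

Definition christoffel_entry3 x u v : R :=
    - (4 * k * x`_1) * (u`_3 * v`_3) - 2 * k * x`_2 * sym2 u v 2%N 3%N.

Definition christoffel_entry4 x u v : R :=
    - (F 0 x / 2 + 2 * k * x`_1) * sym2 u v 2%N 3%N - 4 * k * x`_2 * (u`_4 * v`_4).

Definition walker_christoffel x u v : V :=
  row4 (christoffel_entry1 x u v) (christoffel_entry2 x u v)
    (christoffel_entry3 x u v) (christoffel_entry4 x u v).

Lemma walker_christoffel_entries x u v :
  ((walker_christoffel x u v)`_1 = christoffel_entry1 x u v) *
  ((walker_christoffel x u v)`_2 = christoffel_entry2 x u v) *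
  ((walker_christoffel x u v)`_3 = christoffel_entry3 x u v) *
  ((walker_christoffel x u v)`_4 = christoffel_entry4 x u v).
Proof. by rewrite /walker_christoffel !row4E. Qed.

(* A tactic, since the entries are nested in the curvature. *)
Ltac expand_christoffel :=
  rewrite !walker_christoffel_entries /christoffel_entry1 /christoffel_entry2
    /christoffel_entry3 /christoffel_entry4 /sym2.

Lemma walker_christoffelE x u v : christoffel_form g x u v = walker_christoffel x u v.
Proof.
apply: (inner_nondegenerate g x); first exact: walker_unit.
move=> w; rewrite inner_christoffel; last 3 first.
- exact: differentiable_walker.
- exact: walker_sym.
- exact: walker_unit.
rewrite !derive_inner_walker inner_walker; expand_christoffel.
rewrite /psi33 /psi34 /psi44 /dpsi33 /dpsi34 /dpsi44 /x1 /x2 /x4 /=.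
rewrite /derive1n /=.
by field.
Qed.


Lemma curvature_cst x u v w : curvature g (cst u) (cst v) (cst w) x =
  'D_u (fun z => walker_christoffel z v w) x
    + walker_christoffel x u (walker_christoffel x v w)
  - ('D_v (fun z => walker_christoffel z u w) x
    + walker_christoffel x v (walker_christoffel x u w)).
Proof.
have nablaE a b : nabla g (cst a) (cst b) = (fun z => walker_christoffel z a b).
  by apply/funext => z; rewrite /nabla derive_cst add0r walker_christoffelE.
rewrite /curvature !nablaE /nabla !walker_christoffelE.
rewrite (_ : lie_bracket (cst u) (cst v) x = 0); last first.
  by rewrite /lie_bracket !derive_cst subrr.
rewrite derive0 add0r (_ : walker_christoffel x 0 w = 0) ?subr0//.
by apply: eq_row4; expand_christoffel; rewrite !mxE; ring.
Qed.

Definition dwalker_christoffel x (a u v : V) : V :=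
  let s (i j : nat) := u 0 (inord i) * v 0 (inord j) + u 0 (inord j) * v 0 (inord i) in
  let p := x`_1 in let q := x`_2 in
  let f0 := F 0 x in let f1 := F 1 x in
  let dp := a`_1 in let dq := a`_2 in
  let df0 := F 1 x * a`_4 in let df1 := F 2 x * a`_4 in let df2 := F 3 x * a`_4 in
  row4
   (4 * k * dp * s 0%N 2%N + 2 * k * dq * s 0%N 3%N + (df0 / 2 + 2 * k * dp) * s 1%N 3%N
    + (16 * k ^+ 2 * (3 * p * p * dp) - dp * (f0 * f0) - 2 * p * f0 * df0) * (u`_3 * v`_3)
    + (16 * k ^+ 2 * (2 * p * q * dp + p * p * dq)
       + 4 * k * (dp * q * f0 + p * dq * f0 + p * q * df0)
       - (dp * f1 + p * df1) / 2 - 3 / (8 * k) * (df0 * f1 + f0 * df1)) * s 2%N 3%N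
    + (16 * k ^+ 2 * (dp * q * q + 2 * p * q * dq)
       + 4 * k * (2 * q * dq * f0 + q * q * df0) - df2 / (4 * k)) * (u`_4 * v`_4))
   (2 * k * dq * s 0%N 2%N + (df0 / 2 + 2 * k * dp) * s 1%N 2%N + 4 * k * dq * s 1%N 3%N
    + (16 * k ^+ 2 * (2 * p * q * dp + p * p * dq)
       + 4 * k * (dp * q * f0 + p * dq * f0 + p * q * df0)
       - (dp * f1 + p * df1) + (df0 * f1 + f0 * df1) / (4 * k)) * (u`_3 * v`_3)
    + (16 * k ^+ 2 * (dp * q * q + 2 * p * q * dq)
       + 4 * k * (2 * q * dq * f0 + q * q * df0) - (dq * f1 + q * df1) / 2) * s 2%N 3%N
    + 16 * k ^+ 2 * (3 * q * q * dq) * (u`_4 * v`_4))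
   (- (4 * k * dp) * (u`_3 * v`_3) - 2 * k * dq * s 2%N 3%N)
   (- (df0 / 2 + 2 * k * dp) * s 2%N 3%N - 4 * k * dq * (u`_4 * v`_4)).

Lemma derive_walker_christoffel x a u v :
  'D_a (fun z => walker_christoffel z u v) x = dwalker_christoffel x a u v.
Proof.
apply: derive_of; apply: is_derive_mxP => i j; rewrite (ord1 i).
have -> : j = inord j by rewrite inord_val.
case: j => -[|[|[|[|//]]]] ? /=; rewrite /dwalker_christoffel row4E;
  under eq_fun do expand_christoffel;
  (diff_coords; rewrite /derive1n /=; abstract_jets x; abstract_entries x;
   abstract_entries a; abstract_entries u; abstract_entries v; intros; ring).
Qed.

(** The para-complex structure is the identity on the null plane of the first two
    coordinates and minus the identity on a null complement of it. Such complements
    form a line; the shift singles out the one for which the curvature has no term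
    that mixes the two eigenspaces. *)
Definition para_shift x : R := - (24 * k)^-1 * F 1 x.
Definition para x v : V := row4
  (v`_1 + (psi33 k f x * v`_3 + psi34 k f x * v`_4) - 2 * para_shift x * v`_4)
  (v`_2 + (psi34 k f x * v`_3 + psi44 k x * v`_4) + 2 * para_shift x * v`_3)
  (- v`_3) (- v`_4).
(** The vector dual to the form [y |-> y_3 v_4 - y_4 v_3]. *)
Definition sharp v : V := row4 (v`_4) (- v`_3) 0 0.
Definition jordan_coefficient x : R :=
  (24 * k * F 0 x * F 1 x * x`_2 - 12 * k * F 2 x * x`_1
   + 3 * F 0 x * F 2 x + 4 * F 1 x ^+ 2) / (12 * k).

(** The curvature is that of a space of constant para-holomorphic sectional
    curvature [4 k], plus a nilpotent term that comes from the null two-form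
    [dx_3 wedge dx_4]. *)
Lemma curvature_walker x v y : curvature g (cst y) (cst v) (cst v) x =
  k *: (inner g x v v *: y - inner g x y v *: v)
  - (3 * k * inner g x y (para x v)) *: para x v
  + (jordan_coefficient x * inner g x y (sharp v)) *: sharp v.
Proof.
rewrite curvature_cst !derive_walker_christoffel.
have addE (a b : V) i : (a + b) 0 i = a 0 i + b 0 i by rewrite mxE.
have oppE (a : V) i : (- a) 0 i = - a 0 i by rewrite mxE.
have scaleE c (a : V) i : (c *: a) 0 i = c * a 0 i by rewrite mxE.
apply: eq_row4; rewrite !(addE, oppE, scaleE) !inner_walker.
all: expand_christoffel; expand_christoffel.
all: rewrite /dwalker_christoffel /para /sharp !row4E.
all: rewrite /jordan_coefficient /para_shift /psi33 /psi34 /psi44 /x1 /x2 /x4 /=.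
all: rewrite /derive1n /=.
all: abstract_jets x; abstract_entries x; abstract_entries y; abstract_entries v.
all: by intros; field.
Qed.

End WalkerCurvature.

(** * The coordinate space as a manifold *)

(** Balls with rational centers and radii [1 / m] form a basis. *)
Lemma second_countable_rV {R : realType} (n : nat) : @second_countable 'rV[R]_n.
Proof.
pose B (qm : 'rV[rat]_n * nat) : set 'rV[R]_n :=
  ball (map_mx (@ratr R) qm.1 : 'rV[R]_n) (qm.2.+1%:R)^-1.
exists (range B).
  exact: (card_le_trans (card_image_le _ _) (countableP _)).
split=> [_ [qm _ <-]|x A /nbhs_ballP[e /= e0 xeA]]; first exact: ball_open.
pose m := Num.truncn (2 / e).
pose r : R := (m.+1%:R)^-1.
have r0 : 0 < r by rewrite invr_gt0.
have re : r < e / 2.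
  by rewrite -[e / 2]invrK ltf_pV2 ?posrE ?invr_gt0 ?divr_gt0// invf_div truncnS_gt.
have qP i : exists q : rat, `|x 0 i - ratr q| < r.
  have [|q] := @rat_in_itvoo R (x 0 i - r) (x 0 i + r).
    by rewrite ltrBlDr -addrA ltrDl addr_gt0.
  by rewrite in_itv/= => xq; exists q; rewrite distrC ltr_distl.
have [q qE] := choice qP.
exists (B (\row_i q i, m)).
  split; first by exists (\row_i q i, m).
  rewrite /B /=; split=> // i j; rewrite !mxE (ord1 i) /ball/= distrC.
  exact: qE.
move=> y; rewrite /B /= => -[_ By]; apply: xeA; split=> // i j.
have := By i j; rewrite !mxE /ball /= (ord1 i) => yq.
rewrite (splitr e) (le_lt_trans (ler_distD (ratr (q j)) _ _))// ltrD//.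
  exact: lt_trans (qE j) re.
exact: lt_trans yq re.
Qed.

Section WalkerManifold.
Context {R : realType}.
Variables (k : R) (f : R -> R).
Hypothesis k0 : k != 0.
Hypothesis fsmooth : forall (n : nat) (t : R), derivable (derive1n n f) t 1.
Local Notation g := (walker_metric k f).
Local Notation V := 'rV[R]_4.
Local Notation M := (coordinate_space g).

(** The functions generated by the coordinates and the derivatives of [f] at [x_4].
    They are differentiable and closed under directional derivatives, hence
    smooth. *)
Inductive elementary : (V -> R) -> Prop :=
| elementary_const (a : R) : elementary (fun=> a)
| elementary_coord (i : 'I_4) : elementary (fun z => z 0 i)
| elementary_jet (n : nat) : elementary (fun z => derive1n n f z`_4)
| elementary_add p q : elementary p -> elementary q -> elementary (fun z => p z + q z)
| elementary_mul p q : elementary p -> elementary q -> elementary (fun z => p z * q z).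

Lemma elementary_differentiable p x : elementary p -> differentiable p x.
Proof.
elim=> [a|i|n|{}p q _ dp _ dq|{}p q _ dp _ dq].
- exact: differentiable_const.
- exact: differentiable_coord.
- exact: differentiable_F.
- exact: differentiable_add.
- exact: differentiable_mul.
Qed.

Lemma elementary_derive p v : elementary p -> elementary ('D_v p).
Proof.
have D p' x w : elementary p' -> is_derive x w p' ('D_w p' x).
  by move=> ep; apply: derivableP; apply: diff_derivable; exact: elementary_differentiable.
elim=> [a|i|n|{}p q ep dp eq dq|{}p q ep dp eq dq].
- rewrite (_ : 'D_v _ = fun=> 0); first exact: elementary_const.
  by apply/funext => x; exact: derive_cst.
- rewrite (_ : 'D_v _ = fun=> v 0 i); first exact: elementary_const.
  by apply/funext => x; apply: derive_of; exact: is_derive_coord.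
- rewrite (_ : 'D_v _ = fun x => derive1n n.+1 f x`_4 * v`_4).
    by apply: elementary_mul; [exact: elementary_jet|exact: elementary_const].
  by apply/funext => x; apply: derive_of; exact: is_derive_F.
- rewrite (_ : 'D_v _ = fun x => 'D_v p x + 'D_v q x); first exact: elementary_add.
  by apply/funext => x; apply: derive_of; apply: is_derive_add; exact: D.
- rewrite (_ : 'D_v _ = fun x => p x * 'D_v q x + q x * 'D_v p x).
    by apply: elementary_add; exact: elementary_mul.
  by apply/funext => x; apply: derive_of; apply: is_derive_mul; exact: D.
Qed.

Lemma elementary_smooth {m n : nat} (U : set V) (A : V -> 'M[R]_(m, n)) :
  (forall i j, elementary (fun z => A z i j)) -> smooth_on U A.
Proof.
move=> eA vs x _; apply/differentiable_mxP => i j.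
apply: elementary_differentiable; elim: vs i j => [|v vs IH] i j //=.
rewrite (_ : (fun z => _) =
    'D_v (fun z => foldr (fun v h => 'D_v h) A vs z i j)).
  exact/elementary_derive/IH.
apply/funext => z; rewrite derive_coord//; apply/derivable_mxP => a b.
by apply: diff_derivable; apply: elementary_differentiable; exact: IH.
Qed.

Lemma walker_smooth (U : set V) : smooth_on U g.
Proof.
have ec a : elementary (fun=> a) by exact: elementary_const.
have ex i : elementary (fun z => z 0 i) by exact: elementary_coord.
have ef n : elementary (fun z => derive1n n f z`_4) by exact: elementary_jet.
have e33 : elementary (psi33 k f).
  rewrite (_ : psi33 k f = fun z => 4 * k * (z`_1 * z`_1)
     + - (4 * k)^-1 * (derive1n 0 f z`_4 * derive1n 0 f z`_4)).
    by do ![apply: elementary_add | apply: elementary_mul];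
      try exact: ec; try exact: ex; try exact: ef.
  by apply/funext => z; rewrite /psi33 mulNr !expr2.
have e44 : elementary (psi44 k).
  rewrite (_ : psi44 k = fun z => 4 * k * (z`_2 * z`_2)).
    by do ![apply: elementary_mul]; try exact: ec; try exact: ex.
  by apply/funext => z; rewrite /psi44 !expr2.
have e34 : elementary (psi34 k f).
  rewrite (_ : psi34 k f = fun z => 4 * k * z`_1 * z`_2
     + z`_2 * derive1n 0 f z`_4 + - (4 * k)^-1 * derive1n 1 f z`_4).
    apply: elementary_add; last exact: elementary_mul.
    by apply: elementary_add; apply: elementary_mul => //; apply: elementary_mul.
  by apply/funext => z; rewrite /psi34 mulNr.
apply: elementary_smooth => i j; rewrite /walker_metric.
case: i => -[|[|[|[|//]]]] ?; case: j => -[|[|[|[|//]]]] ?;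
under eq_fun do rewrite mxE /=; exact: ec || assumption.
Qed.

Lemma walker_pseudo_riemannian : pseudo_riemannian 2 2 M.
Proof.
have imT (c : chart M) : chart_image c = setT.
  by apply/seteqP; split => // x _; exists x.
split.
- split; first exact: norm_hausdorff.
  exact: second_countable_rV.
- by move=> x; exists tt.
- move=> c; rewrite imT; split; [exact: openT | exact: openT | | |by []].
  + exact/continuous_subspaceT/(fun x => cvg_id).
  + exact/continuous_subspaceT/(fun x => cvg_id).
- split; first split.
  + by move=> x; exact: cvg_id.
  + by move=> c d; apply: elementary_smooth => i j; rewrite (ord1 i); exact: (elementary_coord j).
  + move=> c d p _ _ /=.
    rewrite (_ : 'J _ _ = 1%:M) ?trmx1 ?mulmx1 ?mul1mx//.
    apply/matrixP => i j; rewrite /jacobian mxE.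
    rewrite (_ : in_charts _ c d = id)// diff_val.
    by rewrite !mxE eqxx /= eq_sym.
- move=> c; rewrite imT; split; first exact: walker_smooth.
  by move=> x _; exact: walker_signature.
Qed.

End WalkerManifold.

(** * The Jacobi operators *)

Section WalkerOsserman.
Context {R : realType}.
Variables (k : R) (f : R -> R).
Hypothesis k0 : k != 0.
Hypothesis fsmooth : forall (n : nat) (t : R), derivable (derive1n n f) t 1.
Local Notation g := (walker_metric k f).
Local Notation V := 'rV[R]_4.
Local Notation M := (coordinate_space g).
Local Notation rho := (jordan_coefficient k f).

(** The matrix of [y |-> g(y, v) w], for operators that act from the right. *)
Lemma mul_dyad n (h : 'rV[R]_n -> 'M[R]_n) x (y v w : 'rV[R]_n) :
  y *m (h x *m v^T *m w) = inner h x y v *: w.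
Proof. by rewrite !mulmxA [y *m _ *m _]mx11_scalar mul_scalar_mx. Qed.

Lemma jacobi_walkerE x v y : y *m jacobi_operator g x v =
  k *: (inner g x v v *: y - inner g x y v *: v)
  - (3 * k * inner g x y (para k f x v)) *: para k f x v
  + (rho x * inner g x y (sharp v)) *: sharp v.
Proof.
pose A : 'M[R]_4 := k *: ((inner g x v v)%:M - g x *m v^T *m v)
  - (3 * k) *: (g x *m (para k f x v)^T *m para k f x v)
  + rho x *: (g x *m (sharp v)^T *m sharp v).
have AE z : z *m A = k *: (inner g x v v *: z - inner g x z v *: v)
  - (3 * k * inner g x z (para k f x v)) *: para k f x v
  + (rho x * inner g x z (sharp v)) *: sharp v.
  rewrite mulmxDr mulmxBr -!scalemxAr mulmxBr mul_mx_scalar !mul_dyad.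
  by rewrite !scalerA.
suff -> : jacobi_operator g x v = A by exact: AE.
apply/row_matrixP => i; rewrite rowE [RHS]rowE AE -curvature_walker// -rowE.
by apply/rowP => j; rewrite !mxE.
Qed.

Section UnitVector.
Variables (x v : V) (eps : R).
Hypothesis eps2 : eps ^+ 2 = 1.
Hypothesis veps : inner g x v v = eps.

Let facts : [/\ inner g x (para k f x v) (para k f x v) = - eps,
  inner g x v (para k f x v) = 0, inner g x (sharp v) v = 0,
  inner g x (sharp v) (para k f x v) = 0 & inner g x (sharp v) (sharp v) = 0].
Proof.
by split; rewrite -?veps !inner_walker /para /sharp !row4E; ring.
Qed.

Let e0 : V := row4 0 0 v`_4 (- v`_3).

(* [v_3] and [v_4] do not both vanish, as [v] would be null. *)
Let e0m : inner g x e0 (sharp v) != 0.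
Proof.
rewrite inner_walker /e0 /sharp !row4E !(mul0r, mulr0, addr0, add0r) mulrNN -!expr2.
apply/negP => /eqP /eqP; rewrite paddr_eq0 ?sqr_ge0// !sqrf_eq0 => /andP[/eqP v4 /eqP v3].
move: eps2; rewrite -veps inner_walker v4 v3 !(mul0r, mulr0, addr0) expr0n /=.
by move/eqP; rewrite eq_sym oner_eq0.
Qed.

Lemma walker_char_poly : char_poly (jacobi_operator g x v) =
  'X * ('X - (4 * (eps * k))%:P) * ('X - (eps * k)%:P) ^+ 2.
Proof.
have [ww vw mv mw mm] := facts.
apply: (osserman_char_poly g x (walker_sym k f x) k (rho x) eps v (para k f x v)
  (sharp v) _ eps2 veps ww vw mv mw mm e0 e0m) => y.
by rewrite jacobi_walkerE veps.
Qed.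

Lemma walker_diagonalizable : diagonalizable (jacobi_operator g x v) <-> rho x = 0.
Proof.
have [ww vw mv mw mm] := facts.
apply: (osserman_diagonalizable g x (walker_sym k f x) k (rho x) eps v (para k f x v)
  (sharp v) _ eps2 veps ww vw mv mw mm e0 e0m) => y.
by rewrite jacobi_walkerE veps.
Qed.

End UnitVector.

Lemma walker_osserman : osserman_with_eigenvalues M [:: 0; 4 * k; k; k].
Proof.
have cpE (c : chart M) (P : M) v : inner_at c P v v = 1 ->
    char_poly (jacobi_at c P v) = \prod_(a <- [:: 0; 4 * k; k; k]) ('X - a%:P).
  move=> v1; rewrite /jacobi_at (walker_char_poly P v 1 (expr1n _ _) v1).
  by rewrite !big_cons big_nil !mul1r mulr1 subr0 expr2 !mulrA.
split=> [c P v d Q w _ v1 _ w1|c P v _]; last exact: cpE.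
by rewrite (cpE c) // (cpE d).
Qed.

Lemma walker_jacobi_diagonalizable (P : V) :
  jacobi_operators_diagonalizable (M := M) P <-> rho P = 0.
Proof.
split=> [dP|rho0 c v _ [v1|v1]].
(* A unit spacelike vector at the given point. *)
- pose v : V := row4 ((1 - psi33 k f P) / 2) 0 1 0.
  have v1 : inner g P v v = 1.
    by rewrite inner_walker /v !row4E; field.
  by apply/(walker_diagonalizable P v 1 (expr1n _ _) v1)/(dP tt v I); left.
- exact/(walker_diagonalizable P v 1 (expr1n _ _) v1).
- by apply/(walker_diagonalizable P v (-1) _ v1) => //; rewrite sqrrN expr1n.
Qed.

End WalkerOsserman.

(** * Geodesic incompleteness *)

Section Calculus.
Context {R : realType}.

Lemma derive0_constant (p : R -> R) : (forall x : R, is_derive x 1 p 0) ->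
  forall s t, p s = p t.
Proof.
move=> dp; suff H s t : s < t -> p s = p t.
  by move=> s t; case: (ltgtP s t) => [/H//|/H->//|->].
move=> st; have cp : {within `[s, t], continuous p}.
  by apply: derivable_within_continuous => x _; case: (dp x).
have [c _] := @MVT R p (fun=> 0) s t st (fun x _ => dp x) cp.
by rewrite mul0r => /eqP; rewrite subr_eq0 => /eqP.
Qed.

(** Otherwise the derivative of the square of [p] vanishes, so the square is constant;
    if this constant is not zero, then [dp] vanishes identically. *)
Lemma nonconstant_point (p dp : R -> R) : (forall x : R, is_derive x 1 p (dp x)) ->
  (exists s t, p s <> p t) -> exists c, p c != 0 /\ dp c != 0.
Proof.
move=> Dp [s [t pst]]; apply: contrapT => no.
have pdp x : p x * dp x = 0.
  apply/eqP; rewrite mulf_eq0; apply/negPn/negP; rewrite negb_or => /andP[a b].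
  by apply: no; exists x.
have sq := derive0_constant (fun x => p x * p x).
have {}sq : forall s t, p s * p s = p t * p t.
  apply: sq => x; notypeclasses refine (is_derive_congr _ _ _ _ _
    (is_derive_mul _ _ _ _ _ _ (Dp x) (Dp x)) _).
  by rewrite pdp addr0.
have [z|nz] := eqVneq (p s) 0.
  by apply: pst; have /esym/eqP := sq s t; rewrite z mul0r mulf_eq0 orbb => /eqP.
apply: pst; apply: derive0_constant => x.
have px : p x != 0.
  apply/eqP => px0; have /eqP := sq s x; rewrite px0 mul0r mulf_eq0 orbb.
  by rewrite (negbTE nz).
have /eqP := pdp x; rewrite mulf_eq0 (negbTE px) /= => /eqP <-.
exact: Dp.
Qed.

Lemma is_derive_inv {V : normedModType R} (p : V -> R) x v dp : p x != 0 ->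
  is_derive x v p dp -> is_derive x v (fun z => (p z)^-1) (- (p x) ^- 2 * dp).
Proof.
move=> px [dpx <-]; apply: DeriveDef; first exact: derivableV.
exact: deriveV.
Qed.

Lemma cvg_row4 {T : Type} (F : set_system T) {FF : Filter F} (a b c d : T -> R)
    (a' b' c' d' : R) :
  a z @[z --> F] --> a' -> b z @[z --> F] --> b' -> c z @[z --> F] --> c' ->
  d z @[z --> F] --> d' ->
  row4 (a z) (b z) (c z) (d z) @[z --> F] --> row4 a' b' c' d'.
Proof.
move=> ca cb cc cd; rewrite [X in _ --> X]row_sum_delta.
under eq_fun do rewrite [row4 _ _ _ _]row_sum_delta.
apply: cvg_bigsum => i; apply: cvgZr_tmp.
have -> : i = inord i by rewrite inord_val.
by case: i => -[|[|[|[|//]]]] ? /=; rewrite row4E; under eq_fun do rewrite row4E.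
Qed.

End Calculus.


Section IncompleteFamily.
Context {R : realType}.
Variables (k : R) (f : R -> R).
Hypothesis k0 : k != 0.
Hypothesis fsmooth : forall (n : nat) (t : R), derivable (derive1n n f) t 1.
Local Notation g := (walker_metric k f).
Local Notation V := 'rV[R]_4.
Local Notation f' := (derive1n 1 f).
Local Notation f'' := (derive1n 2 f).

(** On the surfaces [x_4 = c] the geodesic equation for [x_3] reads
    [x_3'' = 4 k x_1 (x_3')^2]. With the constant value [- f(c) / (4 k)] of [x_1] it
    integrates to a logarithm, and the equation for [x_2] then makes [x_2] a
    multiple of [x_3]. Writing the parameter so that the singularity is at [t = 0]
    for all [c] makes the geodesics of the family comparable up to that time. *)
Definition null_geodesic (c t : R) : V :=
  row4 (- (4 * k)^-1 * f c) ((2 * k)^-1 * f' c * (ln t * (f c)^-1)) (ln t * (f c)^-1) c.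

Definition null_velocity (c t : R) : V :=
  row4 0 ((2 * k)^-1 * f' c * (t^-1 * (f c)^-1)) (t^-1 * (f c)^-1) 0.

Let Df (n : nat) (c : R) : is_derive c 1 (derive1n n f) (derive1n n.+1 f c).
Proof. by rewrite derive1nS derive1E; apply: derivableP; exact: fsmooth. Qed.

Let case4 (P : 'I_4 -> Prop) : P (inord 0) -> P (inord 1) -> P (inord 2) -> P (inord 3) ->
  forall i, P i.
Proof.
move=> P0 P1 P2 P3 i; rewrite -[i]inord_val.
by case: i => -[|[|[|[|]]]].
Qed.

Lemma is_derive_row4 {W : normedModType R} (a b c d : W -> R) (x v : W) a' b' c' d' :
  is_derive x v a a' -> is_derive x v b b' -> is_derive x v c c' -> is_derive x v d d' ->
  is_derive x v (fun z => row4 (a z) (b z) (c z) (d z)) (row4 a' b' c' d').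
Proof.
move=> da db dc dd; apply: is_derive_mxP => i j; rewrite (ord1 i).
by move: j; apply: case4; rewrite row4E; under eq_fun do rewrite row4E.
Qed.

Lemma null_geodesic_equations c s : f c != 0 -> 0 < s ->
  geodesic_equations g (null_geodesic c) (null_velocity c) s.
Proof.
move=> fc s0; have s1 : s != 0 by rewrite gt_eqF.
have dln : is_derive s 1 (@ln R) s^-1 by exact: is_derive1_ln.
have dinv : is_derive s 1 (fun t : R => t^-1) (- s ^- 2 * 1).
  by apply: (is_derive_inv id) => //; exact: is_derive_id.
split.
  notypeclasses refine (is_derive_congr _ _ _ _ _ _ _).
    notypeclasses refine (is_derive_row4 _ _ _ _ _ _ _ _ _ _ _ _ _ _);
      derive_pointwise ltac:(first [exact: dln | exact: dinv]).
  by apply: eq_row4; rewrite /null_velocity !row4E; field; rewrite ?fc ?s1 ?k0.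
notypeclasses refine (is_derive_congr _ _ _ _ _ _ _).
  notypeclasses refine (is_derive_row4 _ _ _ _ _ _ _ _ _ _ _ _ _ _);
    derive_pointwise ltac:(first [exact: dln | exact: dinv]).
rewrite walker_christoffelE//.
have oppE (a : V) i : (- a) 0 i = - a 0 i by rewrite mxE.
apply: eq_row4; rewrite oppE walker_christoffel_entries /christoffel_entry1
    /christoffel_entry2 /christoffel_entry3 /christoffel_entry4 /sym2
    /null_geodesic /null_velocity !row4E /derive1n /=;
  by field; rewrite ?fc ?s1 ?k0.
Qed.

Definition variation_field (c t : R) : V :=
  let y := ln t * (f c)^-1 in
  let dy := - (y * (f c)^-1 * f' c) in
  row4 (- (4 * k)^-1 * f' c) ((2 * k)^-1 * (f'' c * y + f' c * dy)) dy 1.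

Lemma is_derive_null_geodesic c t : f c != 0 ->
  is_derive c 1 (null_geodesic ^~ t) (variation_field c t).
Proof.
move=> fc; have dinv := is_derive_inv f c 1 (f' c) fc (Df 0 c).
notypeclasses refine (is_derive_congr _ _ _ _ _ _ _).
  notypeclasses refine (is_derive_row4 _ _ _ _ _ _ _ _ _ _ _ _ _ _);
    derive_pointwise ltac:(first [exact: dinv | exact: (Df 0) | exact: (Df 1)
      | exact: is_derive_id]).
by apply: eq_row4; rewrite /variation_field !row4E; field; rewrite ?fc ?k0.
Qed.

Lemma derivable_null_velocity c t : f c != 0 -> derivable (null_velocity ^~ t) c 1.
Proof.
move=> fc; have dinv := is_derive_inv f c 1 (f' c) fc (Df 0 c).
suff [] : exists d, is_derive c 1 (null_velocity ^~ t) d by move=> d [].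
eexists; notypeclasses refine (is_derive_row4 _ _ _ _ _ _ _ _ _ _ _ _ _ _);
  derive_pointwise ltac:(first [exact: dinv | exact: (Df 0) | exact: (Df 1)]).
Qed.

Lemma continuous_null_geodesic c t : f c != 0 -> 0 < t ->
  {for (t, c), continuous (fun z : R * R => null_geodesic z.2 z.1)} /\
  {for (t, c), continuous (fun z : R * R => null_velocity z.2 z.1)}.
Proof.
move=> fc t0.
have c1 : z.1 @[z --> (t, c)] --> t by exact: cvg_fst.
have c2 : z.2 @[z --> (t, c)] --> c by exact: cvg_snd.
have cf n : derive1n n f z.2 @[z --> (t, c)] --> derive1n n f c.
  apply: (cvg_comp _ _ c2).
  by apply: derivable_continuous; exact: fsmooth.
have cl : ln z.1 @[z --> (t, c)] --> ln t.
  by apply: (cvg_comp _ _ c1); exact: continuous_ln.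
have ci : (f z.2)^-1 @[z --> (t, c)] --> (f c)^-1 by apply: cvgV => //; exact: (cf 0).
have ct : (z.1)^-1 @[z --> (t, c)] --> t^-1 by apply: cvgV => //; rewrite gt_eqF.
have cst (a : R) : (fun=> a : R) @ (t, c) --> a by exact: cvg_cst.
split; apply: cvg_row4.
- by apply: cvgM; [exact: cst|exact: (cf 0)].
- apply: cvgM; last exact: cvgM.
  by apply: cvgM; [exact: cst|exact: (cf 1)].
- exact: cvgM.
- exact: c2.
- exact: cst.
- apply: cvgM; last exact: cvgM.
  by apply: cvgM; [exact: cst|exact: (cf 1)].
- exact: cvgM.
- exact: cst.
Qed.

Lemma variation_field_norm c t : f c != 0 ->
  inner g (null_geodesic c t) (variation_field c t) (variation_field c t) =
  f'' c / k * (ln t / f c) + f' c ^+ 2 / k * (ln t / f c) ^+ 2.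
Proof.
move=> fc; rewrite inner_walker /variation_field /null_geodesic !row4E.
rewrite /psi33 /psi34 /psi44 /x1 /x2 /x4 !row4E /derive1n /=.
by field; rewrite ?fc ?k0.
Qed.

Lemma quadratic_unbounded (a b K s0 : R) : b != 0 ->
  exists2 s, s0 <= s & K < `|a * s + b * s ^+ 2|.
Proof.
move=> b0; have nb : 0 < `|b| by rewrite normr_gt0.
pose s := `|s0| + 1 + (`|a| + `|K| + 1) / `|b|.
have q0 : 0 <= (`|a| + `|K| + 1) / `|b| by rewrite divr_ge0// !addr_ge0.
have s1 : 1 <= s by rewrite /s; have := normr_ge0 s0; lra.
exists s; first by have := ler_norm s0; rewrite /s; lra.
have bs : `|a| + `|K| + 1 <= `|b| * s.
  rewrite /s mulrDr [_ * (_ / _)]mulrC divfK ?gt_eqF//.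
  have : 0 <= `|b| * (`|s0| + 1) by rewrite mulr_ge0// addr_ge0.
  lra.
have : `|b| * s ^+ 2 - `|a| * s <= `|a * s + b * s ^+ 2|.
  have s0' : 0 <= s by lra.
  have -> : `|b| * s ^+ 2 = `|b * s ^+ 2| by rewrite normrM [`|s ^+ 2|]ger0_norm// sqr_ge0.
  have -> : `|a| * s = `|a * s| by rewrite normrM [`|s|]ger0_norm.
  by rewrite [a * s + _]addrC; exact: lerB_normD.
have : (`|K| + 1) * 1 <= (`|b| * s - `|a|) * s.
  by rewrite ler_pM ?addr_ge0//; lra.
have := ler_norm K; rewrite expr2; lra.
Qed.

(** The coefficient of [(ln t)^2] in the norm of the variation field is not zero at
    [c], so this norm is unbounded near [t = 0]. *)
Lemma walker_not_embeddable : (exists s t : R, f s <> f t) ->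
  ~ exists (p q : nat) (N : manifold_data R 4) (F : coordinate_space g -> N),
    [/\ pseudo_riemannian p q N, geodesically_complete N & isometric_embedding F].
Proof.
move=> fnc [p [q [N [F [NN complete [sF mF _ _]]]]]].
have [c [fc f'c]] := nonconstant_point f f' (Df 0) fnc.
have fnear : \forall c' \near c, f c' != 0.
  have cf : {for c, continuous f} by apply: derivable_continuous; exact: (fsmooth 0).
  have nz : nbhs (f c) [set y | y != 0].
    by apply: open_nbhs_nbhs; split; [exact: open_neq | exact: fc].
  exact: (cf _ nz).
have [K [r [r0 HK]]] := embedded_variation_bounded g N F
  (walker_pseudo_riemannian k f fsmooth) NN complete sF mF null_geodesic null_velocity c
  (filterS (fun c' fc' s s0 => null_geodesic_equations c' s fc' s0) fnear)
  (fun t t0 => (continuous_null_geodesic c t fc t0).1)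
  (fun t t0 => (continuous_null_geodesic c t fc t0).2)
  (fun t _ => ex_derive (is_derive := is_derive_null_geodesic c t fc))
  (fun t _ => derivable_null_velocity c t fc).
have b0 : f' c ^+ 2 / k / f c ^+ 2 != 0.
  by rewrite !mulf_neq0// ?invr_neq0// expf_neq0.
have [s rs] := quadratic_unbounded (- (f'' c / k / f c)) _ K (- ln r) b0.
have er : expR (- s) <= r.
  by rewrite -[r]lnK ?posrE// ler_expR lerNl.
have := HK (expR (- s)); rewrite expR_gt0 er => /(_ isT).
have [_ ->] := is_derive_null_geodesic c (expR (- s)) fc.
rewrite variation_field_norm// expRK => /le_lt_trans/[apply].
rewrite (_ : _ + _ = - (f'' c / k / f c) * s + f' c ^+ 2 / k / f c ^+ 2 * s ^+ 2) ?ltxx//.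
by field; rewrite k0 fc.
Qed.

(** If the manifold were complete, then the identity would embed it in a complete
    manifold. *)
Lemma walker_incomplete : (exists s t : R, f s <> f t) ->
  geodesically_incomplete (coordinate_space g).
Proof.
move=> fnc complete; apply: (walker_not_embeddable fnc).
have Mg := walker_pseudo_riemannian k f fsmooth.
exists 2%N, 2%N, (coordinate_space g), idfun; split=> //.
have [_ _ _ [smooth metric] _] := Mg.
split=> //; move=> U oU; exists U => //.
rewrite image_id; apply/seteqP; split => [x Ux|x []//].
by split=> //; exists x.
Qed.

End IncompleteFamily.

Theorem theorem5p1 (R : realType) (k : R) (f : R -> R) :
  k != 0 ->
  (forall (n : nat) (t : R), derivable (derive1n n f) t 1) ->
  (exists s t : R, f s <> f t) ->
  let M := coordinate_space (walker_metric k f) in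
  [/\ pseudo_riemannian 2 2 M,
      osserman_with_eigenvalues M [:: 0; 4 * k; k; k],
      forall P : 'rV[R]_4,
        jacobi_operators_diagonalizable (M := M) P <->
        24 * k * f (x4 P) * derive1 f (x4 P) * x2 P
        - 12 * k * derive1n 2 f (x4 P) * x1 P
        + 3 * f (x4 P) * derive1n 2 f (x4 P)
        + 4 * derive1 f (x4 P) ^+ 2 = 0,
      geodesically_incomplete M &
      ~ exists (p q : nat) (N : manifold_data R 4) (F : M -> N),
          [/\ pseudo_riemannian p q N, geodesically_complete N &
              isometric_embedding F]].
Proof.
move=> k0 fsmooth fnc M; split.
- exact: walker_pseudo_riemannian.
- exact: walker_osserman.
- move=> P; apply: (iff_trans (walker_jacobi_diagonalizable k f k0 fsmooth P)).
  rewrite /jordan_coefficient -[derive1n 1 f]/(derive1 f) -[derive1n 0 f]/f.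
  have k12 : (12 * k)^-1 != 0 by rewrite invr_eq0 mulf_neq0.
  split=> [/eqP|E]; last by apply/eqP; rewrite mulf_eq0; apply/orP; left; rewrite -E.
  by rewrite mulf_eq0 (negbTE k12) orbF => /eqP.
- exact: walker_incomplete.
- exact: walker_not_embeddable.
Qed.
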